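(* There exist absolute constants $C_1<4.16$ and $C_2<2.42$ such that the following hold. (i) If for some positive random variable $M$, $(Z-Z_i')_+\le M$ for every $1\le i\le n$, then for every real $q\ge2$, $$\|(Z-\mathbb{E}[Z])_-\|_q\le\sqrt{C_1 q\bigl(\|V^+\|_{q/2}\vee q\|M\|_q^2\bigr)} .$$ (ii) If for some positive random variable $M$, $0\le Z-Z_i\le M$ for every $1\le i\le n$, then for every real $q\ge2$, $$\|(Z-\mathbb{E}[Z])_-\|_q\le\sqrt{C_2 q\bigl(\|V\|_{q/2}\vee q\|M\|_q^2\bigr)} .$$
   Context: Let $X_1,\dots,X_n$ be independent random variables taking values in a measurable space $\mathcal{X}$, let $F:\mathcal{X}^n\to\mathbb{R}$ be measurable, and let $Z=F(X_1,\dots,X_n)$, assumed integrable so that $\mathbb{E}[Z]$ is defined. Let $(X_1',\dots,X_n')$ be an independent copy of $(X_1,\dots,X_n)$ and put $Z_i'=F(X_1,\dots,X_{i-1},X_i',X_{i+1},\dots,X_n)$. For each $i$, $Z_i=F_i(X_1,\dots,X_{i-1},X_{i+1},\dots,X_n)$ where $F_i:\mathcal{X}^{n-1}\to\mathbb{R}$ is an arbitrary measurable function. Write $x_+=\max(x,0)$, $x_-=\max(-x,0)$, $a\vee b=\max(a,b)$, $$V^+=\mathbb{E}\Bigl[\sum_{i=1}^n (Z-Z_i')_+^2\,\Big|\,X_1,\dots,X_n\Bigr],\qquad V=\sum_{i=1}^n(Z-Z_i)^2,$$ and, for $q>0$, $\|Y\|_q=(\mathbb{E}|Y|^q)^{1/q}$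 (possibly $+\infty$). ''Absolute'' means not depending on $n$, $q$, $F$, $F_i$, $M$ or the distributions. *)

(* Defs.v *)
(* The measurable structure of \bar R is in measurable_realfun, which all_analysis
   does not export. *)
From mathcomp Require Export all_boot all_order all_algebra.
From mathcomp Require Export all_classical all_reals all_analysis.
From mathcomp Require Export measurable_realfun.

Set Implicit Arguments.
Unset Strict Implicit.
Unset Printing Implicit Defensive.

Export Order.TTheory GRing.Theory Num.Theory.
Export numFieldNormedType.Exports.

Local Open Scope classical_set_scope.
Local Open Scope ring_scope.

Section product_space.
Context {Om E : Type} {n : nat}.

Definition rv_tuple (X : 'I_n -> Om -> E) (w : Om) : n.-tuple E :=
  [tuple X i w | i < n].

Definition replace_coord (X X' : 'I_n -> Om -> E) (i : 'I_n) (w : Om) :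
    n.-tuple E :=
  [tuple (if j == i then X' j w else X j w) | j < n].

Definition delete_coord (X : 'I_n -> Om -> E) (i : 'I_n) (w : Om) :
    n.-1.-tuple E :=
  [tuple X (lift i j) w | j < n.-1].

End product_space.

Section independence.
Local Open Scope ereal_scope.
Context {d d' : measure_display} {Om : measurableType d} {E : measurableType d'}.
Context {R : realType} (P : probability Om R).

Definition mutually_independent (n : nat) (X : 'I_n -> Om -> E) : Prop :=
  forall (J : {set 'I_n}) (A : 'I_n -> set E), (forall i, measurable (A i)) ->
    P (\bigcap_(i in [set` J]) (X i @^-1` A i)) =
    \prod_(i in J) P (X i @^-1` A i).

Definition independent_copy (X X' : Om -> E) : Prop :=
  (forall A B : set E, measurable A -> measurable B ->
    P ((X @^-1` A) `&` (X' @^-1` B)) = P (X @^-1` A) * P (X' @^-1` B)) /\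
  (forall A : set E, measurable A -> P (X' @^-1` A) = P (X @^-1` A)).

(* [W] is a version of the conditional expectation of [U] given [Y]. Both take
   extended real values, so that every nonnegative measurable [U] has one,
   integrable or not. *)
Definition is_cond_expectation (Y : Om -> E) (U W : Om -> \bar R) : Prop :=
  measurable_fun [set: g_sigma_algebra_preimageType Y]
    (W : g_sigma_algebra_preimageType Y -> \bar R) /\
  (forall A : set Om, g_sigma_algebra_preimage Y A ->
    \int[P]_(w in A) W w = \int[P]_(w in A) U w).

End independence.

(* Main.v *)
Require Import Defs.
From HB Require Import structures.
From mathcomp Require Import ring lra.

(** The proof is an entropy method with power functions.  Let theta be decreasing
and 1-Lipschitz, with values in a compact subset of ]0, +oo[, and put
W = theta(Z); the truncations of (Z - E Z)_- are of this form.  Let r >= 2,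
s = r - 1 and p = r / s, so that 1 < p <= 2.

Tensorization.  E[W^r] - E[W^s]^p is the entropy E[phi(f)] - phi(E[f]) of
f = W^s for phi(x) = x^p.  It is at most the sum over i of the mean entropies
with respect to the i-th coordinate alone (power_entropy_tensorization): the
variables are integrated out one after the other, and each step costs at most
the entropy of f itself in that coordinate because the Bregman divergence of
phi is jointly convex (bregman_tangent).

One coordinate.  When X_i is resampled, the entropy is at most the covariance
of W^s and W, and by exchangeability of X_i and X_i' only the increases
D_i = (W(X^(i)) - W(X))_+ <= (Z - Z_i')_+ matter.  This gives
(r - 1) E[D_i^2 (W + D_i)^(r-2)] (gap_le_incr).  When X_i is deleted, the
variational formula for the entropy with the constant theta(Z_i)^s gives
(r / 2) E[D_i^2 (W + D_i)^(r-2)] with D_i = theta(Z_i) - W <= Z - Z_i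
(gap_le_free, bregman_quadratic).

The bound M of the increments.  In the resampling case M may depend on X', so
it cannot be taken out of the conditional expectation V+.  But given X the D_i
are independent, and for a nondecreasing h the mean of sum_i D_i^2 h(D_i) is at
most E[sum_i D_i^2] E[h(max D_i)] + E[max D_i^2 h(max D_i)] (decoupling).  The
extra term replaces V+ by V+ + M^2 and costs a factor 1 + 1/r in norm, which
is harmless since (r - 1)(1 + 1/r) <= r.

Recursion.  Let A be the maximum in the bound to be proved.  The inequalities
of Hoelder and Minkowski now give, with a = 1 for resampling and a = 2 for
deletion,
  |W|_r^r <= |W|_(r-1)^r + (r/a) A (|W|_r + sqrt(A/r))^(r-2),
and |W|_r <= sqrt(C r A) propagates from r - 1 to r as soon as
e^(-1/2) + e^(1/sqrt C) / (a C) < 1 (moment_step).  This holds for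
C = (53/26)^2 < 4.16 when a = 1 and for C = (14/9)^2 < 2.42 when a = 2.
For 1 <= r <= 2 it is enough to bound |W|_2.  The recursion at r = 2, applied
to Z clipped at a high level, bounds its variance, hence the second moment of
the truncations of (Z - E Z)_-.  Monotone convergence removes the truncation. *)

Set Implicit Arguments.
Unset Strict Implicit.
Unset Printing Implicit Defensive.

Local Open Scope classical_set_scope.
Local Open Scope ring_scope.

(** * Inequalities for real powers *)

Section power_inequalities.
Context {R : realType}.
Implicit Types (a b c m r s t x y : R).

Lemma powR_one r : 1 `^ r = 1 :> R.
Proof. by rewrite powR1. Qed.

Lemma le_powR r x y : 0 <= r -> 0 <= x -> x <= y -> x `^ r <= y `^ r.
Proof.
move=> r0 x0 xy; apply: ge0_ler_powR => //; rewrite nnegrE//.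
exact: le_trans xy.
Qed.

Lemma lt_powR r x y : 0 < r -> 0 <= x -> x < y -> x `^ r < y `^ r.
Proof.
move=> r0 x0 xy; apply: gt0_ltr_powR => //; rewrite nnegrE//.
exact: le_trans (ltW xy).
Qed.

Lemma powR_div r x y : 0 <= x -> 0 < y -> (x / y) `^ r = x `^ r / y `^ r.
Proof.
move=> x0 y0; rewrite powRM ?invr_ge0// 1?ltW//.
by rewrite -(powR_inv1 (ltW y0)) -powRrM mulN1r powRN.
Qed.

(** This tangent inequality is Young's inequality in disguise. It yields
    Jensen's inequality, convexity of powers and Hoelder's inequality below. *)
Lemma powR_tangent t x y : 1 <= t -> 0 <= x -> 0 <= y ->
  y `^ t + t * y `^ (t - 1) * (x - y) <= x `^ t.
Proof.
rewrite le_eqVlt => /predU1P[<- x0 y0|t1 x0 y0].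
  by rewrite subrr powRr0 !powRr1// !mul1r subrKC.
have t0 : 0 < t by lra.
have s0 : 0 < t - 1 by lra.
have tn0 : t != 0 by rewrite gt_eqF.
have sn0 : t - 1 != 0 by rewrite gt_eqF.
have h : t^-1 + (t / (t - 1))^-1 = 1 by field; apply/andP.
have := conjugate_powR x0 (powR_ge0 y (t - 1)) t0 (divr_gt0 t0 s0) h.
rewrite -powRrM (_ : (t - 1) * (t / (t - 1)) = t); last by field.
rewrite -(ler_pM2l t0) mulrDr.
rewrite (_ : t * (x `^ t / t) = x `^ t); last by field.
rewrite (_ : t * (y `^ t / (t / (t - 1))) = (t - 1) * y `^ t); last first.
  by field; apply/andP.
have <- : y * y `^ (t - 1) = y `^ t by rewrite mulr_powRB1.
lra.
Qed.

Lemma powR_convex_comb t l x y : 1 <= t -> 0 <= l <= 1 -> 0 <= x -> 0 <= y ->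
  (l * x + (1 - l) * y) `^ t <= l * x `^ t + (1 - l) * y `^ t.
Proof.
move=> t1 /andP[l0 l1] x0 y0.
set z := l * x + (1 - l) * y.
have z0 : 0 <= z by rewrite addr_ge0// mulr_ge0// subr_ge0.
have l1' : 0 <= 1 - l by rewrite subr_ge0.
have := ler_wpM2l l0 (powR_tangent t1 x0 z0).
have := ler_wpM2l l1' (powR_tangent t1 y0 z0).
move: (z `^ (t - 1)) => u.
have : l * (x - z) + (1 - l) * (y - z) = 0 by rewrite /z; ring.
move=> /(congr1 (fun v => t * u * v)); rewrite mulr0 mulrDr.
set A := x - z; set B := y - z.
move=> h h1 h2; lra.
Qed.

Lemma le_of_derive_ge0 (f f' : R -> R) a b : a <= b ->
  (forall x, a <= x <= b -> is_derive x 1 f (f' x)) ->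
  (forall x, a <= x <= b -> 0 <= f' x) -> f a <= f b.
Proof.
move=> ab df f'0.
apply: (@ger0_derive1_le_cc _ f a b); rewrite ?in_itv/= ?lexx ?ab//.
- move=> x; rewrite in_itv/= => /andP[ax xb].
  by have [] : is_derive x 1 f (f' x) by apply: df; lra.
- move=> x; rewrite in_itv/= => /andP[ax xb].
  have /@derive_val h : is_derive x 1 f (f' x) by apply: df; lra.
  by rewrite derive1E h f'0//; lra.
- apply: derivable_within_continuous => x.
  by rewrite in_itv/= => /df[].
Qed.

Lemma le_of_derive_le0 (f f' : R -> R) a b : a <= b ->
  (forall x, a <= x <= b -> is_derive x 1 f (f' x)) ->
  (forall x, a <= x <= b -> f' x <= 0) -> f b <= f a.
Proof.
move=> ab df f'0; rewrite -lerN2.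
apply: (@le_of_derive_ge0 (fun x => - f x) (fun x => - f' x)) => // x h.
  by have := df _ h => ?; exact: is_deriveN.
by rewrite oppr_ge0 f'0.
Qed.

Lemma is_derive_powRD r c x : 0 < x + c ->
  is_derive x 1 (fun z => (z + c) `^ r) (r * (x + c) `^ (r - 1)).
Proof.
move=> xc0.
have := @is_derive1_comp _ (fun z => z `^ r) (fun z => z + c) x
  (r * (x + c) `^ (r - 1)) 1 (is_derive1_powR r xc0).
rewrite mulr1; apply.
rewrite -[X in is_derive _ _ _ X]addr0.
by apply: is_deriveD.
Qed.

(** For b >= 1 the point 1 + (a - 1) / b is a convex combination of 1 and a;
    convexity of the power s at this point, multiplied by b^s, is the claim. Up
    to a factor, the difference of the two sides is the derivative in b of the
    function studied in cross_pos. *)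
Lemma powR_secant_ge s a b : 1 <= s -> 0 < a -> 1 <= b ->
  (b + (a - 1)) `^ s <= b `^ s + (a `^ s - 1) * b `^ (s - 1).
Proof.
move=> s1 a0 b1.
have b0 : 0 < b by lra.
have bn0 : b != 0 by rewrite gt_eqF.
have s0 : s != 0 by rewrite gt_eqF//; lra.
have : 0 <= b^-1 <= 1 by rewrite invr_ge0 ltW//= invf_le1.
move=> /(powR_convex_comb s1)/(_ (ltW a0) ler01).
rewrite powR1 mulr1.
have bs0 : 0 <= b `^ s by exact: powR_ge0.
move=> /(ler_wpM2l bs0).
rewrite -powRM ?(ltW b0)//; last first.
  by rewrite addr_ge0 ?mulr_ge0 ?invr_ge0 ?(ltW a0) ?(ltW b0)// subr_ge0 invf_le1.
have -> : b * (b^-1 * a + (1 - b^-1)) = b + (a - 1) by field.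
move=> /le_trans; apply.
have -> : b `^ s = b * b `^ (s - 1) by rewrite mulr_powRB1//; lra.
by rewrite le_eqVlt; apply/orP; left; apply/eqP; field.
Qed.

(** For b <= 1 it is a that is a convex combination, of 1 and 1 + (a - 1) / b.
    *)
Lemma powR_secant_le s a b : 1 <= s -> 0 < a -> 0 < b <= 1 -> 0 <= b + (a - 1) ->
  b `^ s + (a `^ s - 1) * b `^ (s - 1) <= (b + (a - 1)) `^ s.
Proof.
move=> s1 a0 /andP[b0 b1] m0.
have bn0 : b != 0 by rewrite gt_eqF.
have := powR_convex_comb s1 (_ : 0 <= b <= 1) (divr_ge0 m0 (ltW b0)) ler01.
rewrite ltW// => /(_ b1).
have -> : b * ((b + (a - 1)) / b) + (1 - b) * 1 = a by field.
have bs0 : 0 <= b `^ (s - 1) by exact: powR_ge0.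
move=> /(ler_wpM2l bs0).
have <- : b * b `^ (s - 1) = b `^ s by rewrite mulr_powRB1//; lra.
have e : b `^ (s - 1) * (b * ((b + (a - 1)) / b) `^ s) = (b + (a - 1)) `^ s.
  rewrite mulrA [_ * b]mulrC mulr_powRB1 ?(ltW b0)//; last lra.
  rewrite -powRM ?divr_ge0 ?(ltW b0)//; congr (_ `^ _); by field.
rewrite powR1 mulr1 mulrDr e; lra.
Qed.

End power_inequalities.

Section power_inequalities.
Context {R : realType}.
Implicit Types (a b c m r s t x y : R).

Let crossd s a (s0 : s != 0) x : 0 < x -> 0 < x + (a - 1) ->
  is_derive x 1
    (fun z => (z `^ (s + 1) + (s + 1) / s * (a `^ s - 1) * z `^ s)
              - (z + (a - 1)) `^ (s + 1))
    ((s + 1) * (x `^ s + (a `^ s - 1) * x `^ (s - 1) - (x + (a - 1)) `^ s)).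
Proof.
move=> x0 m0.
have h1 := is_derive1_powR (s + 1) x0.
have h2 := is_derive1_powR s x0.
have h3 := is_derive_powRD (s + 1) m0.
have h4 := @is_deriveZ _ _ _ (fun z => z `^ s)
  ((s + 1) / s * (a `^ s - 1)) x 1 _ h2.
apply: is_derive_eq; rewrite /GRing.scale/= addrK; field; exact: s0.
Qed.

Let crossd0 s a (s0 : s != 0) x : 0 < x ->
  is_derive x 1
    (fun z => z `^ (s + 1) + (s + 1) / s * (a `^ s - 1) * z `^ s)
    ((s + 1) * (x `^ s + (a `^ s - 1) * x `^ (s - 1))).
Proof.
move=> x0.
have h1 := is_derive1_powR (s + 1) x0.
have h2 := is_derive1_powR s x0.
have h4 := @is_deriveZ _ _ _ (fun z => z `^ s)
  ((s + 1) / s * (a `^ s - 1)) x 1 _ h2.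
apply: is_derive_eq; rewrite /GRing.scale/= addrK; field; exact: s0.
Qed.

Let cross_val s a : s != 0 -> 0 <= a ->
  1 `^ (s + 1) + (s + 1) / s * (a `^ s - 1) * 1 `^ s - (1 + (a - 1)) `^ (s + 1)
  = 1 + (s + 1) / s * (a `^ s - 1) - a `^ (s + 1).
Proof. by move=> s0 a0; rewrite !powR1 mulr1 addrC subrKC addrC. Qed.

(** Both sides agree at b = 1, and by the two secant inequalities the
    derivative in b of their difference has the sign of b - 1. *)
Lemma cross_pos s a b : 1 <= s -> 0 < a -> 0 < b -> 0 < b + (a - 1) ->
  (b + (a - 1)) `^ (s + 1) <=
  b `^ (s + 1) + a `^ (s + 1) - 1 + (s + 1) / s * (a `^ s - 1) * (b `^ s - 1).
Proof.
move=> s1 a0 b0 m0.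
have s0 : s != 0 by rewrite gt_eqF//; lra.
have s10 : 0 < s + 1 by lra.
pose f := (fun z => (z `^ (s + 1) + (s + 1) / s * (a `^ s - 1) * z `^ s)
              - (z + (a - 1)) `^ (s + 1)).
suff : f 1 <= f b.
  rewrite /f cross_val ?(ltW a0)// => h.
  by rewrite -lerBlDl in h *; move: h; lra.
have [b1|b1] := leP 1 b.
- apply: le_of_derive_ge0 b1 _ _ => x /andP[x1 xb]; first by apply: crossd; lra.
  rewrite pmulr_rge0// subr_ge0; exact: powR_secant_ge.
- apply: le_of_derive_le0 (ltW b1) _ _ => x /andP[bx x1].
    by apply: crossd; lra.
  rewrite pmulr_rle0// subr_le0; apply: powR_secant_le => //; lra.
Qed.

(** Here a + b <= 1, and the right-hand side decreases in b up to c = 1 - a^s,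
    a point beyond b where cross_pos applies. *)
Lemma cross_nonpos s a b : 1 <= s -> 0 < a -> 0 < b -> b + (a - 1) <= 0 ->
  0 <=
  b `^ (s + 1) + a `^ (s + 1) - 1 + (s + 1) / s * (a `^ s - 1) * (b `^ s - 1).
Proof.
rewrite le_eqVlt => /predU1P[<-|s1] a0 b0 m0.
  rewrite !powRr1 ?(ltW a0) ?(ltW b0)// divr1 -[1 + 1]/(2%:R).
  rewrite !powR_mulrn ?(ltW a0) ?(ltW b0)//.
  have := sqr_ge0 (b + (a - 1)); nra.
have s0 : s != 0 by rewrite gt_eqF//; lra.
have s10 : 0 < s + 1 by lra.
have a1 : a < 1 by lra.
have asa : a `^ s < a.
  rewrite -(mulr_powRB1 (ltW a0))//; last lra.
  rewrite gtr_pMr//.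
  have : a `^ (s - 1) < 1 `^ (s - 1) by apply: lt_powR => //; lra.
  by rewrite powR_one.
have as0 : 0 < a `^ s by rewrite powR_gt0.
(* the derivative in b vanishes at c *)
pose c := 1 - a `^ s.
have c0 : 0 < c by rewrite /c; lra.
have mc : 0 < c + (a - 1) by rewrite /c; lra.
have := cross_pos (ltW s1) a0 c0 mc.
have := powR_ge0 (c + (a - 1)) (s + 1).
have bc : b <= c by rewrite /c; lra.
have := le_of_derive_le0 bc (f := fun z =>
  z `^ (s + 1) + (s + 1) / s * (a `^ s - 1) * z `^ s)
  (f' := fun x => (s + 1) * (x `^ s + (a `^ s - 1) * x `^ (s - 1))).
have d x : b <= x <= c -> is_derive x 1
    (fun z => z `^ (s + 1) + (s + 1) / s * (a `^ s - 1) * z `^ s)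
    ((s + 1) * (x `^ s + (a `^ s - 1) * x `^ (s - 1))).
  by move=> /andP[bx _]; apply: crossd0; lra.
move=> /(_ d) h.
have : c `^ (s + 1) + (s + 1) / s * (a `^ s - 1) * c `^ s <=
       b `^ (s + 1) + (s + 1) / s * (a `^ s - 1) * b `^ s.
  apply: h => x /andP[bx xc]; rewrite pmulr_rle0//.
  rewrite -(mulr_powRB1 (_ : 0 <= x))//; try lra.
  rewrite -mulrDl; apply: mulr_le0_ge0; last exact: powR_ge0.
  by move: xc; rewrite /c; lra.
rewrite !mulrBr !mulr1; lra.
Qed.

(** Joint convexity of the Bregman divergence of phi(x) = x^(1 + 1/s), in the
    form of a tangent inequality at (a^s, c^s) for its value at (u^s, b^s),
    multiplied by s. The minimum over u is explicit and reduces the claim to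
    the two preceding lemmas, after scaling to c = 1. *)
Lemma bregman_tangent s u a b c : 1 <= s -> 0 < u -> 0 < a -> 0 < b -> 0 < c ->
  (s + 1) * (a + b - c) * u `^ s <=
  s * u `^ (s + 1) + b `^ (s + 1) + a `^ (s + 1) - c `^ (s + 1)
  + (s + 1) / s * c `^ (1 - s) * (a `^ s - c `^ s) * (b `^ s - c `^ s).
Proof.
move=> s1 u0 a0 b0 c0.
have s0 : s != 0 by rewrite gt_eqF//; lra.
have cn0 : c != 0 by rewrite gt_eqF//.
have ca0 : 0 < a / c by rewrite divr_gt0.
have cb0 : 0 < b / c by rewrite divr_gt0.
set p := (s + 1) / s.
suff h : s * (u / c) `^ (s + 1) - (s + 1) * (b / c + (a / c - 1)) * (u / c) `^ s
   + ((b / c) `^ (s + 1) + (a / c) `^ (s + 1) - 1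
      + p * ((a / c) `^ s - 1) * ((b / c) `^ s - 1)) >= 0.
  have cs0 : 0 < c `^ (s + 1) by rewrite powR_gt0.
  move: h; rewrite -(pmulr_rge0 _ cs0).
  rewrite !(powR_div _ _ c0) ?(ltW u0) ?(ltW a0) ?(ltW b0)//.
  have -> : c `^ (s + 1) = c * c `^ s.
    by rewrite powRD ?cn0 ?implybT// powRr1 ?ltW// mulrC.
  have -> : c `^ (1 - s) = c / c `^ s.
    by rewrite powRD ?cn0 ?implybT// powRr1 ?ltW// powRN.
  have csn : c `^ s != 0 by rewrite gt_eqF// powR_gt0.
  have xE x : 0 < x -> x `^ (s + 1) = x * x `^ s.
    by move=> x0; rewrite -(mulr_powRB1 (ltW x0)) ?addrK//; lra.
  rewrite !xE// /p; move: csn s0 cn0; clear.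
  move: (c `^ s) (u `^ s) (a `^ s) (b `^ s) => C U A B C0 s0 c0 h.
  rewrite -subr_ge0; apply: le_trans h _.
  rewrite le_eqVlt; apply/orP; left; apply/eqP.
  by field; rewrite c0 C0 s0.
have cu0 : 0 < u / c by rewrite divr_gt0.
move: (u / c) (a / c) (b / c) cu0 ca0 cb0 => {u0 a0 b0}u' a' b' u0 a0 b0.
move: u' a' b' u0 a0 b0 => {}u {}a {}b u0 a0 b0.
have [m0|m0] := ltP 0 (b + (a - 1)).
  have := cross_pos s1 a0 b0 m0.
  have := powR_tangent (_ : 1 <= s + 1) (ltW m0) (ltW u0).
  rewrite addrK -(mulr_powRB1 (ltW u0) (_ : 0 < s + 1)); last lra.
  rewrite addrK -/p => /(_ ltac:(lra)); move: (u `^ s) => us.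
  lra.
have := cross_nonpos s1 a0 b0 m0; rewrite -/p.
have : 0 <= s * u `^ (s + 1) by rewrite mulr_ge0 ?powR_ge0//; lra.
have : (s + 1) * (b + (a - 1)) * u `^ s <= 0.
  by rewrite mulr_le0_ge0 ?powR_ge0// mulr_ge0_le0//; lra.
lra.
Qed.

(** The two sides and their first derivatives in x agree at x = y; up to the
    factor r - 1 the left-hand side is the Bregman divergence of x^(r - 1) and
    y^(r - 1) for the power r / (r - 1). *)
Lemma bregman_quadratic r x y : 2 <= r -> 0 < x -> x <= y ->
  x `^ r + (r - 1)^-1 * y `^ r - r / (r - 1) * y * x `^ (r - 1)
  <= r / 2 * y `^ (r - 2) * (y - x) ^+ 2.
Proof.
move=> r2 x0 xy.
have y0 : 0 < y by exact: lt_le_trans xy.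
have r0 : 0 < r by lra.
have rn0 : r - 1 != 0 by rewrite gt_eqF//; lra.
rewrite -subr_ge0.
pose f z := r / 2 * y `^ (r - 2) * (z - y) ^+ 2 -
  (z `^ r + (r - 1)^-1 * y `^ r - r / (r - 1) * y * z `^ (r - 1)).
pose f' z := r * y `^ (r - 2) * (z - y) -
  (r * z `^ (r - 1) - r * y * z `^ (r - 1 - 1)).
have yE z : 0 < z -> z `^ (r - 1) = z * z `^ (r - 2).
  move=> z0; rewrite (_ : r - 2 = r - 1 - 1); last lra.
  by rewrite mulr_powRB1//; lra.
have yrE : y `^ r = y * y `^ (r - 1) by rewrite mulr_powRB1//; lra.
have fy : f y = 0.
  by rewrite /f yrE; field.
suff : f y <= f x by rewrite fy /f -(sqrrN (x - y)) opprB.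
apply: (@le_of_derive_le0 _ f f' x y xy) => z /andP[xz zy].
  have z0 : 0 < z by lra.
  have h1 := is_derive1_powR r z0.
  have h2 := is_derive1_powR (r - 1) z0.
  have h3 := @is_deriveZ _ _ _ (fun z => z `^ (r - 1))
    (r / (r - 1) * y) z 1 _ h2.
  have h4 : is_derive z 1 (fun z => r / 2 * y `^ (r - 2) * (z - y) ^+ 2)
     (r * y `^ (r - 2) * (z - y)).
    by apply: is_derive_eq; rewrite /GRing.scale/=; field.
  by apply: is_derive_eq; rewrite /f' /GRing.scale/=; field.
have z0 : 0 < z by lra.
have e : r - 1 - 1 = r - 2 by lra.
rewrite /f' (yE _ z0) e.
have : z `^ (r - 2) <= y `^ (r - 2) by apply: le_powR; lra.
move: (z `^ (r - 2)) (y `^ (r - 2)) => p q pq.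
have : 0 <= r * (q - p) * (y - z) by rewrite !mulr_ge0//; lra.
lra.
Qed.

End power_inequalities.

(** * Expectations of bounded functions *)

Section bounded_measurable.
Context {d : measure_display} {T : measurableType d} {R : realType}.
Implicit Types (f g : T -> R).

(** Truncation makes every function bounded, so that its expectation is a real
    number and all linearity and monotonicity rules hold without side
    conditions on integrability. *)
Definition bdm f := measurable_fun [set: T] f /\ exists k, forall x, `|f x| <= k.

Lemma bdm_cst c : bdm (fun=> c).
Proof. by split; [exact: measurable_cst|exists `|c|]. Qed.

Lemma bdmD f g : bdm f -> bdm g -> bdm (fun x => f x + g x).
Proof.
move=> [mf [k fk]] [mg [l gl]]; split; first exact: measurable_funD.
by exists (k + l) => x; rewrite (le_trans (ler_normD _ _))// lerD.
Qed.

Lemma bdmM f g : bdm f -> bdm g -> bdm (fun x => f x * g x).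
Proof.
move=> [mf [k fk]] [mg [l gl]]; split; first exact: measurable_funM.
by exists (k * l) => x; rewrite normrM ler_pM.
Qed.

Lemma bdmZ c f : bdm f -> bdm (fun x => c * f x).
Proof. by move=> bf; apply: bdmM => //; exact: bdm_cst. Qed.

Lemma bdmN f : bdm f -> bdm (fun x => - f x).
Proof.
by move=> /(bdmZ (-1)); congr bdm; apply/funext => x; rewrite mulN1r.
Qed.

Lemma bdmB f g : bdm f -> bdm g -> bdm (fun x => f x - g x).
Proof. by move=> bf bg; apply: bdmD => //; exact: bdmN. Qed.

Lemma bdmX n f : bdm f -> bdm (fun x => f x ^+ n).
Proof.
move=> bf; elim: n => [|n ih]; first by under eq_fun do rewrite expr0; exact: bdm_cst.
by under eq_fun do rewrite exprS; exact: bdmM.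
Qed.

Lemma bdm_sum (I : Type) (s : seq I) (F : I -> T -> R) :
  (forall i, bdm (F i)) -> bdm (fun x => \sum_(i <- s) F i x).
Proof.
move=> bF; elim: s => [|i s ih].
  by under eq_fun do rewrite big_nil; exact: bdm_cst.
by under eq_fun do rewrite big_cons; exact: bdmD.
Qed.

Lemma bdm_max f g : bdm f -> bdm g -> bdm (fun x => Num.max (f x) (g x)).
Proof.
move=> [mf [k fk]] [mg [l gl]]; split; first exact: measurable_maxr.
exists (Num.max k l) => x; rewrite le_max.
by case: (leP (f x) (g x)) => _; rewrite ?fk ?gl ?orbT.
Qed.

Lemma bdm_min f g : bdm f -> bdm g -> bdm (fun x => Num.min (f x) (g x)).
Proof.
move=> [mf [k fk]] [mg [l gl]]; split; first exact: measurable_minr.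
exists (Num.max k l) => x; rewrite le_max.
by case: (leP (f x) (g x)) => _; rewrite ?fk ?gl ?orbT.
Qed.

Lemma bdm_powR f t : 0 <= t -> (forall x, 0 <= f x) -> bdm f ->
  bdm (fun x => f x `^ t).
Proof.
move=> t0 f0 [mf [k fk]]; split.
  exact: (measurableT_comp (measurable_powR t)).
exists (k `^ t) => x; rewrite ger0_norm ?powR_ge0//.
by apply: le_powR => //; rewrite (le_trans (ler_norm _)).
Qed.

(** The exponent t may be negative, as in the factor c^(1 - s) of
    bregman_tangent. *)
Lemma bdm_powR_pos f t c : 0 < c -> (forall x, c <= f x) -> bdm f ->
  bdm (fun x => f x `^ t).
Proof.
move=> c0 f0 [mf [k fk]]; split.
  exact: (measurableT_comp (measurable_powR t)).
have fx0 x : 0 < f x by exact: lt_le_trans (f0 x).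
exists (k `^ t + c `^ t) => x; rewrite ger0_norm ?powR_ge0//.
have [t0|/ltW t0] := leP 0 t.
  rewrite ler_wpDr ?powR_ge0// le_powR ?(ltW (fx0 x))//.
  by rewrite (le_trans (ler_norm _)).
rewrite ler_wpDl ?powR_ge0// -[t]opprK !(powRN _ (- t)).
rewrite lef_pV2 ?posrE ?powR_gt0//.
by apply: le_powR => //; rewrite ?oppr_ge0// ltW.
Qed.

End bounded_measurable.

Lemma bdm_comp {d d' : measure_display} {T : measurableType d}
    {T' : measurableType d'} {R : realType} (h : T -> T') (f : T' -> R) :
  measurable_fun [set: T] h -> bdm f -> bdm (fun x => f (h x)).
Proof.
move=> mh [mf [k fk]]; split; last by exists k.
exact: (measurableT_comp mf).
Qed.

Lemma bdm_bounded_comp {d : measure_display} {T : measurableType d}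
    {R : realType} (theta : R -> R) (F : T -> R) (l k : R) :
  measurable_fun [set: R] theta -> measurable_fun [set: T] F ->
  (forall a, l <= theta a) -> (forall a, theta a <= k) ->
  bdm (fun x => theta (F x)).
Proof.
move=> mt mF lt tk; split; first exact: (measurableT_comp mt mF).
exists (Num.max (- l) k) => x.
by rewrite ler_norml -lerNl !le_max tk orbT andbT lerNl opprK lt.
Qed.

Lemma bdm_indic {d : measure_display} {T : measurableType d} {R : realType}
    (D : set T) : measurable D -> bdm (\1_D : T -> R).
Proof.
move=> mD; split; first exact: measurable_indic.
by exists 1 => x; rewrite indicE; case: (_ \in _); rewrite ?normr1 ?normr0.
Qed.

Section expectation.
Context {d : measure_display} {T : measurableType d} {R : realType}.
Variable P : probability T R.
Implicit Types (f g : T -> R).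

Lemma bdm_integrable f : bdm f -> P.-integrable [set: T] (EFin \o f).
Proof.
move=> [mf [k fk]]; apply: measurable_bounded_integrable => //.
  exact: fin_num_fun_lty.
exists k; split; first by rewrite num_real.
by move=> l kl x _ /=; rewrite (le_trans (fk x))// ltW.
Qed.

Local Notation "''E' f" := (Rintegral P [set: T] f) (at level 10, f at next level).

Lemma integral_bdm f : bdm f -> (\int[P]_x (f x)%:E)%E = ('E f)%:E.
Proof.
move=> bf; rewrite /Rintegral fineK//.
exact: integrable_fin_num (bdm_integrable bf).
Qed.

Lemma bE_cst c : 'E (fun=> c) = c.
Proof.
rewrite Rintegral_cst//.
have h := congr1 fine (probability_setT P).
by rewrite -[RHS]mulr1 -[X in _ = _ * X]h.
Qed.

Lemma bE_D f g : bdm f -> bdm g -> 'E (fun x => f x + g x) = 'E f + 'E g.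
Proof. by move=> bf bg; rewrite RintegralD//; exact: bdm_integrable. Qed.

Lemma bE_Z c f : bdm f -> 'E (fun x => c * f x) = c * 'E f.
Proof. by move=> bf; rewrite RintegralZl//; exact: bdm_integrable. Qed.

Lemma bE_B f g : bdm f -> bdm g -> 'E (fun x => f x - g x) = 'E f - 'E g.
Proof. by move=> bf bg; rewrite RintegralB//; exact: bdm_integrable. Qed.

Lemma bE_sum (I : Type) (s : seq I) (F : I -> T -> R) :
  (forall i, bdm (F i)) ->
  'E (fun x => \sum_(i <- s) F i x) = \sum_(i <- s) 'E (F i).
Proof.
move=> bF; elim: s => [|i s ih].
  by under eq_Rintegral do rewrite big_nil; rewrite bE_cst big_nil.
under eq_Rintegral do rewrite big_cons.
by rewrite bE_D ?ih ?big_cons//; exact: bdm_sum.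
Qed.

Lemma eq_bE f g : f =1 g -> 'E f = 'E g.
Proof. by move=> fg; apply: eq_Rintegral => x _; exact: fg. Qed.

Lemma bE_le f g : bdm f -> bdm g -> (forall x, f x <= g x) -> 'E f <= 'E g.
Proof.
move=> bf bg fg; apply: le_Rintegral => //; exact: bdm_integrable.
Qed.

Lemma bE_ge0 f : (forall x, 0 <= f x) -> 0 <= 'E f.
Proof. by move=> f0; apply: Rintegral_ge0 => x _; exact: f0. Qed.

Lemma bE_le_ae f g : bdm f -> bdm g -> {ae P, forall x, f x <= g x} ->
  'E f <= 'E g.
Proof.
move=> bf bg fg.
have bm := bdm_min bf bg.
have -> : 'E f = 'E (fun x => Num.min (f x) (g x)).
  congr fine; apply: ae_eq_integral => //.
  - by apply/measurable_EFinP; case: bf.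
  - by apply/measurable_EFinP; case: bm.
  - by apply: filterS fg => x /= fg _; congr EFin; rewrite min_l.
by apply: bE_le => // x; rewrite ge_min lexx orbT.
Qed.

Lemma bE_gt0 c f : 0 < c -> bdm f -> (forall x, c <= f x) -> 0 < 'E f.
Proof.
move=> c0 bf cf; apply: (lt_le_trans c0).
by rewrite -[leLHS]bE_cst; apply: bE_le => //; exact: bdm_cst.
Qed.

(** The tangent inequality at the mean, integrated. *)
Lemma bE_jensen f t : 1 <= t -> bdm f -> (forall x, 0 <= f x) ->
  ('E f) `^ t <= 'E (fun x => f x `^ t).
Proof.
move=> t1 bf f0; set m := 'E f.
have m0 : 0 <= m by exact: bE_ge0.
have -> : m `^ t = 'E (fun x => m `^ t + t * m `^ (t - 1) * (f x - m)).
  rewrite bE_D; [|exact: bdm_cst|]; last first.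
    by apply: bdmZ; apply: bdmB => //; exact: bdm_cst.
  rewrite bE_cst bE_Z; last by apply: bdmB => //; exact: bdm_cst.
  by rewrite bE_B//; [rewrite bE_cst subrr mulr0 addr0|exact: bdm_cst].
apply: bE_le => [||x]; last by apply: powR_tangent.
  apply: bdmD; first exact: bdm_cst.
  by apply: bdmZ; apply: bdmB => //; exact: bdm_cst.
by apply: bdm_powR => //; lra.
Qed.

(** Minkowski's inequality, stated through upper bounds a and b of the norms.
    It is the convexity of the power t with weights a / (a + b) and b / (a +
    b), integrated. *)
Lemma bE_minkowski f g t a b : 1 <= t -> bdm f -> bdm g ->
  (forall x, 0 <= f x) -> (forall x, 0 <= g x) -> 0 < a -> 0 < b ->
  'E (fun x => f x `^ t) <= a `^ t -> 'E (fun x => g x `^ t) <= b `^ t ->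
  'E (fun x => (f x + g x) `^ t) <= (a + b) `^ t.
Proof.
move=> t1 bf bg f0 g0 a0 b0 fa gb.
have t0 : 0 <= t by clear -t1 P; lra.
have ab0 : 0 < a + b by rewrite addr_gt0.
pose l := a / (a + b).
have l0 : 0 < l by rewrite divr_gt0.
have l1 : 1 - l = b / (a + b) by rewrite /l; field; rewrite gt_eqF.
have l1p : 0 < 1 - l by rewrite l1 divr_gt0.
pose u := a + b.
have H x : (f x + g x) `^ t <=
   u `^ t * (l / a `^ t) * f x `^ t + u `^ t * ((1 - l) / b `^ t) * g x `^ t.
  have -> : f x + g x = u * (l * (f x / a) + (1 - l) * (g x / b)).
    by rewrite l1 /l /u; field; rewrite !gt_eqF.
  rewrite powRM ?(ltW ab0)//; last first.
    by rewrite addr_ge0// mulr_ge0 ?(ltW l0) ?(ltW l1p)// divr_ge0// ltW.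
  have := @powR_convex_comb _ t l (f x / a) (g x / b) t1.
  rewrite (ltW l0)/= => /(_ ltac:(clear -l1p P; lra)).
  rewrite !divr_ge0 ?(ltW a0) ?(ltW b0)// => /(_ isT isT).
  rewrite !powR_div// => /(ler_wpM2l (powR_ge0 u t)) /le_trans; apply.
  by rewrite le_eqVlt; apply/orP; left; apply/eqP; ring.
have bft := bdm_powR t0 f0 bf.
have bgt := bdm_powR t0 g0 bg.
have := bE_le _ _ H.
rewrite bE_D; [|exact: bdmZ|exact: bdmZ]; rewrite !bE_Z// => /(_ _ _)/le_trans; apply.
- by apply: bdm_powR => //; [move=> x; rewrite addr_ge0|exact: bdmD].
- by apply: bdmD; exact: bdmZ.
have at0 : 0 < a `^ t by rewrite powR_gt0.
have bt0 : 0 < b `^ t by rewrite powR_gt0.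
apply: (@le_trans _ _ (u `^ t * (l / a `^ t) * a `^ t +
    u `^ t * ((1 - l) / b `^ t) * b `^ t)).
  by rewrite lerD// ler_wpM2l// mulr_ge0 ?powR_ge0// divr_ge0 ?ltW.
by rewrite le_eqVlt; apply/orP; left; apply/eqP; field; rewrite !gt_eqF.
Qed.

(** Hoelder's inequality with exponents r / 2 and r / (r - 2), which also
    covers r = 2. Young's inequality is the tangent inequality of the power r /
    2 at the square of g / b. *)
Lemma bE_holder f g r a b : 2 <= r -> bdm f -> bdm g ->
  (forall x, 0 <= f x) -> (forall x, 0 <= g x) -> 0 < a -> 0 < b ->
  'E (fun x => f x `^ (r / 2)) <= a `^ (r / 2) ->
  'E (fun x => g x `^ r) <= b `^ r ->
  'E (fun x => f x * g x `^ (r - 2)) <= a * b `^ (r - 2).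
Proof.
move=> r2 bf bg f0 g0 a0 b0 fa gb.
have t1 : 1 <= r / 2 by clear -r2 P; lra.
have r0 : 0 < r by clear -r2 P; lra.
have br0 : 0 < b `^ r by rewrite powR_gt0.
have br20 : 0 < b `^ (r - 2) by rewrite powR_gt0.
have ar0 : 0 < a `^ (r / 2) by rewrite powR_gt0.
have H x : f x * g x `^ (r - 2) <= a * b `^ (r - 2) *
  (2 / r / a `^ (r / 2) * f x `^ (r / 2) + (1 - 2 / r) / b `^ r * g x `^ r).
  have ga0 : 0 <= g x / b by rewrite divr_ge0// ltW.
  have sq z t : 0 <= z -> (z ^+ 2) `^ t = z `^ (t * 2).
    by move=> z0; rewrite -powR_mulrn// -powRrM mulrC.
  have := powR_tangent t1 (divr_ge0 (f0 x) (ltW a0)) (sqr_ge0 (g x / b)).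
  rewrite !sq// (_ : r / 2 * 2 = r); last by clear -r P; lra.
  rewrite (_ : (r / 2 - 1) * 2 = r - 2); last by clear -r P; lra.
  have gE : (g x / b) `^ r = (g x / b) ^+ 2 * (g x / b) `^ (r - 2).
    move: ga0; rewrite le_eqVlt => /predU1P[<-|ga0].
      by rewrite powR0 ?gt_eqF// expr0n/= mul0r.
    rewrite -powR_mulrn ?(ltW ga0)// -powRD; last first.
      by apply/implyP => _; rewrite gt_eqF.
    by congr (_ `^ _); clear -r P; lra.
  move=> h; have : f x / a * (g x / b) `^ (r - 2) <=
     2 / r * (f x / a) `^ (r / 2) + (1 - 2 / r) * (g x / b) `^ r.
    rewrite -(ler_pM2l r0) -(ler_pM2l (_ : 0 < 2^-1))//.
    have -> : 2^-1 * (r * (2 / r * (f x / a) `^ (r / 2) +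
        (1 - 2 / r) * (g x / b) `^ r)) =
        (f x / a) `^ (r / 2) + (r / 2 - 1) * (g x / b) `^ r.
      by field; rewrite gt_eqF.
    by move: h; rewrite gE; clear -f g r x a b P; lra.
  rewrite !powR_div// => /(ler_wpM2l (mulr_ge0 (ltW a0) (ltW br20))).
  have -> : a * b `^ (r - 2) * (f x / a * (g x `^ (r - 2) / b `^ (r - 2))) =
     f x * g x `^ (r - 2) by field; rewrite !gt_eqF.
  move=> /le_trans; apply.
  by rewrite le_eqVlt; apply/orP; left; apply/eqP; field; rewrite !gt_eqF.
have r20 : 0 <= r / 2 by clear -r2 P; lra.
have bft := bdm_powR r20 f0 bf.
have bgt := bdm_powR (ltW r0) g0 bg.
have r22 : 0 <= r - 2 by clear -r2 P; lra.
have bgt' := bdm_powR r22 g0 bg.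
have := bE_le _ _ H.
rewrite bE_Z; last by apply: bdmD; exact: bdmZ.
rewrite bE_D; [|exact: bdmZ|exact: bdmZ]; rewrite !bE_Z// => /(_ _ _)/le_trans; apply.
- exact: bdmM.
- by apply: bdmZ; apply: bdmD; exact: bdmZ.
rewrite -[leRHS]mulr1 ler_wpM2l ?mulr_ge0 ?(ltW a0) ?(ltW br20)//.
apply: (@le_trans _ _ (2 / r / a `^ (r / 2) * a `^ (r / 2) +
    (1 - 2 / r) / b `^ r * b `^ r)).
  have h2 : 2 / r <= 1 by rewrite ler_pdivrMr// mul1r.
  by apply: lerD; apply: ler_wpM2l => //; rewrite divr_ge0 ?powR_ge0//
    ?subr_ge0// divr_ge0// ltW.
by rewrite le_eqVlt; apply/orP; left; apply/eqP; field; rewrite !gt_eqF.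
Qed.

End expectation.

(** * Iterated expectations, independence and laws on tuples *)

Notation "''EE_' P f" := (Rintegral P [set: _] f)
  (at level 10, P at level 2, f at next level).

Section iterated_expectation.
Context {d1 d2 : measure_display} {T1 : measurableType d1}
  {T2 : measurableType d2} {R : realType}.
Variables (P1 : probability T1 R) (P2 : probability T2 R).
Implicit Types (G : T1 * T2 -> R).

Lemma bdm_pairl G x : bdm G -> bdm (fun y => G (x, y)).
Proof. by move=> bG; apply: bdm_comp bG; exact: measurable_pair1. Qed.

Lemma bdm_pairr G y : bdm G -> bdm (fun x => G (x, y)).
Proof. by move=> bG; apply: bdm_comp bG; exact: measurable_pair2. Qed.

Lemma bdm_bE G : bdm G -> bdm (fun x => 'EE_P2 (fun y => G (x, y))).
Proof.
move=> bG; split.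
  apply/measurable_EFinP.
  have := measurable_fubini_F (bdm_integrable (P1 \x P2)%E bG).
  by apply: eq_measurable_fun => x _; rewrite /fubini_F/= integral_bdm//;
    exact: bdm_pairl.
have [mG [k Gk]] := bG; exists k => x.
rewrite ler_norml; apply/andP; split.
- rewrite -(bE_cst P2 (- k)); apply: bE_le => [||y].
  + exact: bdm_cst.
  + exact: bdm_pairl.
  + by have := Gk (x, y); rewrite ler_norml => /andP[].
- rewrite -[leRHS](bE_cst P2 k); apply: bE_le => [||y].
  + exact: bdm_pairl.
  + exact: bdm_cst.
  + by have := Gk (x, y); rewrite ler_norml => /andP[].
Qed.

Lemma bE_prod G : bdm G ->
  'EE_(P1 \x P2)%E G = 'EE_P1 (fun x => 'EE_P2 (fun y => G (x, y))).
Proof.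
move=> bG; congr fine.
rewrite -(integral12_prod_meas1 (bdm_integrable (P1 \x P2)%E bG)).
apply: eq_integral => x _; rewrite /fubini_F/= integral_bdm//.
exact: bdm_pairl.
Qed.

End iterated_expectation.

Lemma bE_swap {d1 d2 : measure_display} {T1 : measurableType d1}
  {T2 : measurableType d2} {R : realType}
  (P1 : probability T1 R) (P2 : probability T2 R) (G : T1 * T2 -> R) : bdm G ->
  'EE_P1 (fun x => 'EE_P2 (fun y => G (x, y))) =
  'EE_P2 (fun y => 'EE_P1 (fun x => G (x, y))).
Proof.
move=> bG; congr fine.
transitivity (\int[P1]_x \int[P2]_y (G (x, y))%:E)%E.
  by apply: eq_integral => x _; rewrite -integral_bdm//; exact: bdm_pairl.
rewrite (Fubini (bdm_integrable (P1 \x P2)%E bG)).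
by apply: eq_integral => y _; rewrite -integral_bdm//; exact: bdm_pairr.
Qed.

Section laws.
Context {d d' : measure_display} {T : measurableType d} {T' : measurableType d'}
  {R : realType}.

Lemma bE_law (P : probability T R) (Q : probability T' R) (h : T -> T')
    (f : T' -> R) : measurable_fun [set: T] h -> bdm f ->
  (forall A, measurable A -> Q A = P (h @^-1` A)) ->
  'EE_Q f = 'EE_P (fun w => f (h w)).
Proof.
move=> mh bf QP.
pose H : {mfun T >-> T'} := HB.pack h (isMeasurableFun.Build _ _ _ _ h mh).
transitivity ('EE_(distribution P H) f).
  by congr fine; apply: eq_measure_integral => A mA _; exact: QP.
congr fine; rewrite integral_distribution//.
  by apply/measurable_EFinP; case: bf.
by apply: bdm_integrable; exact: bdm_comp bf.
Qed.

End laws.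

(** The law of the pair is the product measure, by uniqueness on rectangles. *)
Lemma bE_indep {d d1 d2 : measure_display} {T : measurableType d}
  {T1 : measurableType d1} {T2 : measurableType d2} {R : realType}
  (P : probability T R) (Y1 : T -> T1) (Y2 : T -> T2) (G : T1 * T2 -> R) :
  measurable_fun [set: T] Y1 -> measurable_fun [set: T] Y2 -> bdm G ->
  (forall A B, measurable A -> measurable B ->
    P ((Y1 @^-1` A) `&` (Y2 @^-1` B)) = P (Y1 @^-1` A) * P (Y2 @^-1` B))%E ->
  'EE_P (fun w => G (Y1 w, Y2 w)) =
  'EE_P (fun w => 'EE_P (fun w' => G (Y1 w, Y2 w'))).
Proof.
move=> mY1 mY2 bG ind.
pose H1 : {mfun T >-> T1} := HB.pack Y1 (isMeasurableFun.Build _ _ _ _ Y1 mY1).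
pose H2 : {mfun T >-> T2} := HB.pack Y2 (isMeasurableFun.Build _ _ _ _ Y2 mY2).
have mY : measurable_fun [set: T] (fun w => (Y1 w, Y2 w)).
  exact: measurable_fun_pair.
pose H : {mfun T >-> (T1 * T2)%type} :=
  HB.pack (fun w => (Y1 w, Y2 w)) (isMeasurableFun.Build _ _ _ _ _ mY).
pose P1 := distribution P H1; pose P2 := distribution P H2.
rewrite -(@bE_law _ _ _ _ _ P (P1 \x P2)%E (fun w => (Y1 w, Y2 w)) G mY bG).
  rewrite bE_prod//.
  rewrite (@bE_law _ _ _ _ _ P P1 Y1 _ mY1 (bdm_bE P1 P2 bG))//.
  apply: eq_bE => w.
  by rewrite (@bE_law _ _ _ _ _ P P2 Y2 _ mY2 (bdm_pairl (Y1 w) bG)).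
move=> A mA.
exact: (@product_measure_unique _ _ _ _ _ P1 P2 (distribution P H) ind).
Qed.

Section tuples.
Context {d : measure_display} {E : measurableType d} {R : realType} {n : nat}.

Definition box (A : 'I_n -> set E) : set (n.-tuple E) :=
  [set x | forall i, A i (tnth x i)].

Lemma measurable_box A : (forall i, measurable (A i)) -> measurable (box A).
Proof.
move=> mA.
have -> : box A = \big[setI/setT]_(i < n) ((@tnth n E)^~ i @^-1` A i).
  rewrite -bigcap_seq; apply/seteqP; split=> [x Ax i _|x Ax i]; first exact: Ax.
  by apply: Ax => /=; rewrite mem_index_enum.
apply: bigsetI_measurable => i _; rewrite -[X in measurable X]setTI.
exact: measurable_tnth.
Qed.

(** Boxes are stable under intersection and generate the sigma-algebra of
    tuples. *)
Lemma tuple_measure_unique (P Q : probability (n.-tuple E) R) :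
  (forall A, (forall i, measurable (A i)) -> P (box A) = Q (box A)) ->
  forall B, measurable B -> P B = Q B.
Proof.
move=> PQ B mB.
pose C : set (set (n.-tuple E)) :=
  [set D | exists2 A, (forall i, measurable (A i)) & D = box A].
have boxT : box (fun=> setT) = setT by apply/seteqP; split.
apply: (measure_unique C (fun=> setT)) => //.
- apply/seteqP; split=> [D|D].
    apply: smallest_sub; first exact: smallest_sigma_algebra.
    rewrite -bigcup_seq => _ [i _ [A mA <-]].
    apply: sub_sigma_algebra; exists (fun j => if j == i then A else setT).
      by move=> j; case: ifP.
    rewrite setTI; apply/seteqP; split=> [x Ax j|x /(_ i)].
      by case: eqP => // ->.
    by rewrite eqxx.
  apply: smallest_sub; first exact: sigma_algebra_measurable.
  by move=> _ [A mA ->]; exact: measurable_box.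
- move=> _ _ [A1 m1 ->] [A2 m2 ->]; exists (fun i => A1 i `&` A2 i).
    by move=> i; exact: measurableI.
  apply/seteqP; split=> [x [x1 x2] i|x h]; first by split; [exact: x1|exact: x2].
  by split=> i; have [] := h i.
- by move=> _; exists (fun=> setT).
- by rewrite bigcup_const.
- by move=> _ [A mA ->]; exact: PQ.
- by move=> _; apply: (le_lt_trans (probability_le1 P _)) => //; rewrite ltry.
Qed.

End tuples.

(** * Averaging over one coordinate *)

Section update.
Context {E : Type} {n : nat}.
Implicit Types (x : n.-tuple E) (i j : 'I_n) (y z : E).

Definition upd x i y : n.-tuple E :=
  [tuple (if j == i then y else tnth x j) | j < n].

Lemma tnth_upd x i y j : tnth (upd x i y) j = if j == i then y else tnth x j.
Proof. by rewrite tnth_mktuple. Qed.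

Lemma upd_upd x i y z : upd (upd x i y) i z = upd x i z.
Proof. by apply: eq_from_tnth => j; rewrite !tnth_upd; case: eqP. Qed.

Lemma upd_comm x i j y z : i != j -> upd (upd x i y) j z = upd (upd x j z) i y.
Proof.
move=> ij; apply: eq_from_tnth => k; rewrite !tnth_upd.
by case: eqP => // ->; rewrite eq_sym (negbTE ij).
Qed.

Definition coord_free {S : Type} i (f : n.-tuple E -> S) :=
  forall x y, f (upd x i y) = f x.

End update.

Lemma measurable_upd {d : measure_display} {E : measurableType d} {n : nat}
    (i : 'I_n) : measurable_fun [set: n.-tuple E * E] (fun p => upd p.1 i p.2).
Proof.
apply/measurable_fun_tnthP => j.
have [->|ji] := eqVneq j i.
  rewrite [X in measurable_fun _ X](_ : _ = snd)//.
  by apply/funext => p /=; rewrite tnth_upd eqxx.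
rewrite [X in measurable_fun _ X](_ : _ = (@tnth n E)^~ j \o fst).
  exact: (measurableT_comp (measurable_tnth j)).
by apply/funext => p /=; rewrite tnth_upd (negbTE ji).
Qed.

Section coordinate_expectation.
Context {d d' : measure_display} {Om : measurableType d} {E : measurableType d'}.
Context {R : realType} {P : probability Om R} {n : nat}.
Variable X : 'I_n -> {RV P >-> E}.
Implicit Types (f g : n.-tuple E -> R) (i j : 'I_n).

Lemma measurable_rv_tuple : measurable_fun [set: Om] (rv_tuple X).
Proof.
apply/measurable_fun_tnthP => j.
apply: (eq_measurable_fun (X j)) => [w _ /=|]; first by rewrite tnth_mktuple.
exact: measurable_funPT.
Qed.

Definition tuple_mean f := 'EE_P (fun w => f (rv_tuple X w)).
Definition coord_mean i f x := 'EE_P (fun w => f (upd x i (X i w))).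

Local Notation Ex := tuple_mean.

Lemma bdm_rv f : bdm f -> bdm (fun w => f (rv_tuple X w)).
Proof. by apply: bdm_comp; exact: measurable_rv_tuple. Qed.

Lemma measurable_upd_rv i :
  measurable_fun [set: n.-tuple E * Om] (fun p => upd p.1 i (X i p.2)).
Proof.
have -> : (fun p : n.-tuple E * Om => upd p.1 i (X i p.2)) =
    (fun p => upd p.1 i p.2) \o (fun p => (p.1, X i p.2)) by [].
apply: (measurableT_comp (measurable_upd i)).
apply: measurable_fun_pair => //.
exact: (measurableT_comp (measurable_funPT (X i))).
Qed.

Lemma bdm_upd2 i f : bdm f ->
  bdm (fun p : n.-tuple E * Om => f (upd p.1 i (X i p.2))).
Proof. by apply: bdm_comp; exact: measurable_upd_rv. Qed.

Lemma bdm_upd i f x : bdm f -> bdm (fun w => f (upd x i (X i w))).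
Proof. by move=> bf; exact: (bdm_pairl x (bdm_upd2 i bf)). Qed.

Lemma Ex_cst c : Ex (fun=> c) = c.
Proof. exact: bE_cst. Qed.

Lemma Ex_D f g : bdm f -> bdm g -> Ex (fun x => f x + g x) = Ex f + Ex g.
Proof. by move=> bf bg; apply: bE_D; exact: bdm_rv. Qed.

Lemma Ex_B f g : bdm f -> bdm g -> Ex (fun x => f x - g x) = Ex f - Ex g.
Proof. by move=> bf bg; apply: bE_B; exact: bdm_rv. Qed.

Lemma Ex_Z c f : bdm f -> Ex (fun x => c * f x) = c * Ex f.
Proof. by move=> bf; apply: bE_Z; exact: bdm_rv. Qed.

Lemma Ex_sum (I : Type) (s : seq I) (F : I -> n.-tuple E -> R) :
  (forall k, bdm (F k)) ->
  Ex (fun x => \sum_(k <- s) F k x) = \sum_(k <- s) Ex (F k).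
Proof. by move=> bF; apply: bE_sum => k; exact: bdm_rv. Qed.

Lemma eq_Ex f g : f =1 g -> Ex f = Ex g.
Proof. by move=> fg; apply: eq_bE => w; exact: fg. Qed.

Lemma Ex_le f g : bdm f -> bdm g -> (forall x, f x <= g x) -> Ex f <= Ex g.
Proof. by move=> bf bg fg; apply: bE_le => //; exact: bdm_rv. Qed.

End coordinate_expectation.

Section resampling.
Context {d d' : measure_display} {Om : measurableType d} {E : measurableType d'}.
Context {R : realType} {P : probability Om R} {n : nat}.
Variable X : 'I_n -> {RV P >-> E}.
Hypothesis indX : mutually_independent P X.
Implicit Types (f g : n.-tuple E -> R) (i j : 'I_n).
Local Notation Ex := (@tuple_mean _ _ _ _ R P n X).
Local Notation Ei := (@coord_mean _ _ _ _ R P n X).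

Let law_rv : {mfun Om >-> n.-tuple E} :=
  HB.pack (rv_tuple X) (isMeasurableFun.Build _ _ _ _ _ (measurable_rv_tuple X)).

Lemma bdm_EE (G : n.-tuple E * Om -> R) : bdm G ->
  bdm (fun x => 'EE_P (fun w => G (x, w))).
Proof. exact: (bdm_bE (distribution P law_rv) P). Qed.

Lemma bdm_Ei i f : bdm f -> bdm (Ei i f).
Proof. by move=> bf; exact: (bdm_EE (bdm_upd2 X i bf)). Qed.

(** Replacing X_i by an independent copy does not change the law of X; on boxes
    this is mutual independence for the full index set and for the complement
    of i. *)
Lemma Ex_Ei i f : bdm f -> Ex (Ei i f) = Ex f.
Proof.
move=> bf; rewrite /tuple_mean /coord_mean.
pose h (p : Om * Om) := upd (rv_tuple X p.1) i (X i p.2).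
have mh : measurable_fun [set: Om * Om] h.
  have -> : h = (fun p : n.-tuple E * Om => upd p.1 i (X i p.2)) \o
     (fun p => (rv_tuple X p.1, p.2)) by [].
  apply: (measurableT_comp (measurable_upd_rv X i)).
  apply: measurable_fun_pair => //.
  exact: (measurableT_comp (measurable_rv_tuple X)).
pose H : {mfun (Om * Om)%type >-> n.-tuple E} :=
  HB.pack h (isMeasurableFun.Build _ _ _ _ _ mh).
transitivity ('EE_(P \x P)%E (fun p => f (h p))).
  by rewrite bE_prod//; exact: bdm_comp bf.
rewrite -(@bE_law _ _ _ _ _ P (distribution P law_rv) _ f)//; last first.
  exact: measurable_rv_tuple.
rewrite -(@bE_law _ _ _ _ _ (P \x P)%E (distribution (P \x P)%E H) _ f)//.
congr fine; apply: eq_measure_integral => A mA _.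
apply: (tuple_measure_unique _ mA) => {mA}A mA.
have e1 : P (rv_tuple X @^-1` box A) = (\prod_(j < n) P (X j @^-1` A j))%E.
  have -> : rv_tuple X @^-1` box A =
      \bigcap_(j in [set` [set: 'I_n]%SET]) (X j @^-1` A j).
    apply/seteqP; split=> [w Aw j _|w Aw j].
      by have := Aw j; rewrite tnth_mktuple.
    by rewrite tnth_mktuple; apply: Aw => /=; rewrite inE.
  by rewrite indX//; apply: eq_bigl => j; rewrite inE.
have e2 : (P \x P)%E (h @^-1` box A) = (\prod_(j < n) P (X j @^-1` A j))%E.
  have mX j : measurable (X j @^-1` A j) by exact: measurable_funPTI.
  have -> : h @^-1` box A =
      (\bigcap_(j in [set` [set~ i]%SET]) (X j @^-1` A j)) `*` (X i @^-1` A i).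
    apply/seteqP; split=> [[w w'] Aw|[w w'] [/= Aw Aw'] j].
      split=> /=.
        move=> j /=; rewrite !inE => /negbTE ji.
        by have := Aw j; rewrite tnth_upd ji tnth_mktuple.
      by have := Aw i; rewrite tnth_upd eqxx.
    rewrite tnth_upd; case: eqP => [->//|/eqP ji].
    by rewrite tnth_mktuple; apply: Aw => /=; rewrite !inE.
  rewrite product_measure1E//=; last first.
    by apply: fin_bigcap_measurable => // j _; exact: mX.
  rewrite indX// [RHS](bigD1 i)//= muleC; congr (_ * _)%E.
  by apply: eq_bigl => j; rewrite !inE.
exact: etrans e2 (esym e1).
Qed.

Lemma Ei_coord_free i f : coord_free i (Ei i f).
Proof. by move=> x y; apply: eq_bE => w; rewrite upd_upd. Qed.

Lemma coord_free_Ei i j f : coord_free j f -> coord_free j (Ei i f).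
Proof.
move=> fj; have [->|ij] := eqVneq i j; first exact: Ei_coord_free.
move=> x y; apply: eq_bE => w.
by rewrite upd_comm 1?eq_sym// fj.
Qed.

Lemma Ei_free_mul i f g x : coord_free i g -> bdm f ->
  Ei i (fun x => g x * f x) x = g x * Ei i f x.
Proof.
move=> gi bf; rewrite /coord_mean -(bE_Z _ _ (bdm_upd X i x bf)).
by apply: eq_bE => w; rewrite gi.
Qed.

(** The one-coordinate average is the conditional expectation given the other
    coordinates. *)
Lemma Ex_free_mul i f g : coord_free i g -> bdm g -> bdm f ->
  Ex (fun x => g x * Ei i f x) = Ex (fun x => g x * f x).
Proof.
move=> gi bg bf; rewrite -[RHS](Ex_Ei i); last exact: bdmM.
by apply: eq_bE => w; rewrite Ei_free_mul.
Qed.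

End resampling.

(** * Tensorization of the power entropy *)

Lemma coord_free_cst {E S : Type} {n : nat} (f : n.-tuple E -> S) :
  (forall i, coord_free i f) -> forall x y, f x = f y.
Proof.
move=> ff x y.
pose z l := foldr (fun i t => upd t i (tnth y i)) x l.
have fz l : f (z l) = f x by elim: l => //= i l; rewrite ff.
rewrite -(fz (enum 'I_n)); congr f; apply: eq_from_tnth => j.
have : j \in enum 'I_n by rewrite mem_enum.
elim: (enum 'I_n) => //= i l ih; rewrite inE tnth_upd.
by case: eqP => [->//|_ /=]; exact: ih.
Qed.

Lemma gap_arith {R : realType} (s a b c e : R) : 0 < s ->
  (s + 1) * (a + b - c) <= s * e + b + a - c -> b - c <= e - a.
Proof. by move=> s0 h; rewrite -(ler_pM2l s0); lra. Qed.

Lemma sub_swap {R : realType} (a b c e : R) : a - b <= e -> c - e <= c + b - a.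
Proof. lra. Qed.

Lemma root_mul {R : realType} (s a : R) : 1 <= s -> 0 < a ->
  a `^ s^-1 * a = a `^ (1 + s^-1).
Proof.
move=> s1 a0; rewrite addrC powRD ?powRr1 ?(ltW a0)//.
by apply/implyP => _; rewrite gt_eqF.
Qed.

(** The inequality bregman_tangent in the variables a, b, c for which it
    expresses joint convexity. *)
Lemma bregman_tangent_root {R : realType} (s w a b c : R) :
  1 <= s -> 0 < w -> 0 < a -> 0 < b -> 0 < c ->
  (s + 1) * (a `^ s^-1 * w `^ s + b `^ s^-1 * w `^ s - c `^ s^-1 * w `^ s) <=
  s * w `^ (s + 1) + b `^ (1 + s^-1) + a `^ (1 + s^-1) - c `^ (1 + s^-1) +
  (s + 1) / s * ((c `^ s^-1) `^ (1 - s) * (a - c) * (b - c)).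
Proof.
move=> s1 w0 a0 b0 c0; have s0 : 0 < s by lra.
have rootK x : 0 < x -> (x `^ s^-1) `^ s = x.
  by move=> x0; rewrite -powRrM mulVf ?gt_eqF// powRr1 ?ltW.
have rootS x : 0 < x -> (x `^ s^-1) `^ (s + 1) = x `^ (1 + s^-1).
  by move=> x0; rewrite -powRrM mulrDr mulr1 mulVf ?gt_eqF.
have := bregman_tangent s1 w0 (powR_gt0 s^-1 a0) (powR_gt0 s^-1 b0)
  (powR_gt0 s^-1 c0).
rewrite !rootS// !rootK//; move: (w `^ s) (w `^ (s + 1)) ((s + 1) / s) => u v t.
move: (a `^ s^-1) (b `^ s^-1) (c `^ s^-1) => x y z.
by rewrite [leRHS](_ : _ = s * v + b `^ (1 + s^-1) + a `^ (1 + s^-1) -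
  c `^ (1 + s^-1) + t * (z `^ (1 - s) * (a - c) * (b - c)));
  [rewrite [leLHS](_ : _ = (s + 1) * (x * u + y * u - z * u))//|]; ring.
Qed.

Lemma sub_telescope {R : realType} (u v w s t : R) :
  w - v <= s -> v - u <= t -> w - u <= t + s.
Proof. lra. Qed.

Section tensorization.
Context {d d' : measure_display} {Om : measurableType d} {E : measurableType d'}.
Context {R : realType} {P : probability Om R} {n : nat}.
Variable X : 'I_n -> {RV P >-> E}.
Hypothesis indX : mutually_independent P X.
Local Notation Ex := (@tuple_mean _ _ _ _ R P n X).
Local Notation Ei := (@coord_mean _ _ _ _ R P n X).
Implicit Types (f g : n.-tuple E -> R) (i j : 'I_n).

Lemma Ei_ge c i f : bdm f -> (forall x, c <= f x) -> forall x, c <= Ei i f x.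
Proof.
move=> bf cf x; rewrite -[leLHS](bE_cst P c); apply: bE_le => //.
  exact: bdm_cst.
exact: (bdm_upd X i x bf).
Qed.

Variables (s : R) (W : n.-tuple E -> R) (eps : R).
Hypotheses (s1 : 1 <= s) (bW : bdm W) (eps0 : 0 < eps)
  (epsW : forall x, eps <= W x).
Let f x := W x `^ s.
Let p := 1 + s^-1.

Let s0 : 0 < s. Proof. exact: lt_le_trans ltr01 s1. Qed.
Let W0 x : 0 < W x. Proof. exact: lt_le_trans (epsW x). Qed.
Let c := eps `^ s.
Let c0 : 0 < c. Proof. by rewrite powR_gt0. Qed.
Let bf : bdm f. Proof. by apply: bdm_powR bW; rewrite ?(ltW s0)// => x; exact: ltW. Qed.
Let cf x : c <= f x. Proof. by apply: le_powR; rewrite ?(ltW s0) ?(ltW eps0). Qed.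

(** The one-coordinate entropy does not increase when f is replaced by its
    average g over other coordinates. The two hypotheses on g say that g is
    such an average; in the mean of the tangent inequality every linear term
    then cancels or becomes a moment. *)
Lemma gap_averaging i g :
  bdm g -> (forall x, c <= g x) ->
  (Ex (fun x => g x `^ s^-1 * f x) = Ex (fun x => g x `^ s^-1 * g x)) ->
  (Ex (fun x => Ei i g x `^ s^-1 * f x) = Ex (fun x => Ei i g x `^ s^-1 * g x)) ->
  Ex (fun x => g x `^ p) - Ex (fun x => Ei i g x `^ p) <=
  Ex (fun x => W x `^ (s + 1)) - Ex (fun x => Ei i f x `^ p).
Proof.
move=> bg cg gf gif.
have bh : bdm (Ei i f) by exact: bdm_Ei.
have bk : bdm (Ei i g) by exact: bdm_Ei.
have hc := Ei_ge i bf cf; have kc := Ei_ge i bg cg.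
have h0 x : 0 < Ei i f x by exact: lt_le_trans (hc x).
have k0 x : 0 < Ei i g x by exact: lt_le_trans (kc x).
have g0 x : 0 < g x by exact: lt_le_trans (cg x).
have bgr t : bdm (fun x => g x `^ t) by exact: (bdm_powR_pos t c0 cg bg).
have bhr t : bdm (fun x => Ei i f x `^ t) by exact: (bdm_powR_pos t c0 hc bh).
have bkr t : bdm (fun x => Ei i g x `^ t) by exact: (bdm_powR_pos t c0 kc bk).
have bWr t : bdm (fun x => W x `^ t) by exact: (bdm_powR_pos t eps0 epsW bW).
have hi : coord_free i (Ei i f) by exact: Ei_coord_free.
have ki : coord_free i (Ei i g) by exact: Ei_coord_free.
have e1 : Ex (fun x => g x `^ s^-1 * f x) = Ex (fun x => g x `^ p).
  by rewrite gf; apply: eq_Ex => x; rewrite (root_mul s1).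
have e2 : Ex (fun x => Ei i f x `^ s^-1 * f x) = Ex (fun x => Ei i f x `^ p).
  have free : coord_free i (fun x => Ei i f x `^ s^-1).
    by move=> x y; rewrite hi.
  rewrite -(Ex_free_mul indX free (bhr _) bf).
  by apply: eq_Ex => x; rewrite (root_mul s1).
have e3 : Ex (fun x => Ei i g x `^ s^-1 * f x) = Ex (fun x => Ei i g x `^ p).
  have free : coord_free i (fun x => Ei i g x `^ s^-1).
    by move=> x y; rewrite ki.
  rewrite gif -(Ex_free_mul indX free (bkr _) bg).
  by apply: eq_Ex => x; rewrite (root_mul s1).
pose psi x := (Ei i g x `^ s^-1) `^ (1 - s) * (Ei i f x - Ei i g x).
have bpsi : bdm psi.
  apply: bdmM; last exact: bdmB.
  by under eq_fun do rewrite -powRrM; exact: bkr.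
(* the linear term in the second argument: psi does not depend on coordinate i
   *)
have e4 : Ex (fun x => psi x * (g x - Ei i g x)) = 0.
  have -> : Ex (fun x => psi x * (g x - Ei i g x)) =
      Ex (fun x => psi x * g x) - Ex (fun x => psi x * Ei i g x).
    rewrite -Ex_B; [|exact: bdmM|exact: bdmM].
    by apply: eq_Ex => x; rewrite mulrBr.
  have free : coord_free i psi by move=> x y; rewrite /psi hi ki.
  by rewrite (Ex_free_mul indX free bpsi bg) subrr.
have H x : (s + 1) * (Ei i f x `^ s^-1 * f x + g x `^ s^-1 * f x -
      Ei i g x `^ s^-1 * f x) <=
    s * W x `^ (s + 1) + g x `^ p + Ei i f x `^ p - Ei i g x `^ p +
    (s + 1) / s * (psi x * (g x - Ei i g x)).
  exact: bregman_tangent_root s1 (W0 x) (h0 x) (g0 x) (k0 x).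
have b1 : bdm (fun x => Ei i f x `^ s^-1 * f x) by exact: bdmM.
have b2 : bdm (fun x => g x `^ s^-1 * f x) by exact: bdmM.
have b3 : bdm (fun x => Ei i g x `^ s^-1 * f x) by exact: bdmM.
have b4 : bdm (fun x => psi x * (g x - Ei i g x)) by apply: bdmM => //; exact: bdmB.
have bL := bdmZ (s + 1) (bdmB (bdmD b1 b2) b3).
have bWs := bdmZ s (bWr (s + 1)).
have bZ := bdmZ ((s + 1) / s) b4.
have bM := bdmB (bdmD (bdmD bWs (bgr p)) (bhr p)) (bkr p).
have := Ex_le X bL (bdmD bM bZ) H.
rewrite (Ex_Z X _ (bdmB (bdmD b1 b2) b3)) (Ex_B X (bdmD b1 b2) b3).
rewrite (Ex_D X b1 b2) e1 e2 e3 (Ex_D X bM bZ) (Ex_Z X _ b4) e4.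
rewrite (Ex_B X (bdmD (bdmD bWs (bgr p)) (bhr p)) (bkr p)).
rewrite (Ex_D X (bdmD bWs (bgr p)) (bhr p)) (Ex_D X bWs (bgr p)).
rewrite (Ex_Z X _ (bWr (s + 1))).
rewrite mulr0 addr0; exact: gap_arith s0.
Qed.

(** Integrate out the coordinates one by one, starting from f = W^s and ending
    with its mean. The total entropy telescopes into the steps bounded by
    gap_averaging. *)
Lemma power_entropy_tensorization :
  Ex (fun x => W x `^ (s + 1)) - Ex (fun x => W x `^ s) `^ p <=
  \sum_i (Ex (fun x => W x `^ (s + 1)) - Ex (fun x => Ei i f x `^ p)).
Proof.
pose G (l : seq 'I_n) := foldr (fun i g => Ei i g) f l.
have bG l : bdm (G l) by elim: l => [|i l ih]; [exact: bf|exact: bdm_Ei ih].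
have cG l x : c <= G l x.
  elim: l x => [|i l ih] x; [exact: cf|exact: (Ei_ge i (bG l) ih x)].
have Gfree l j : j \in l -> coord_free j (G l).
  elim: l => //= i l ih; rewrite inE => /predU1P[->|jl].
    exact: Ei_coord_free.
  exact: coord_free_Ei (ih jl).
have Gswap l psi : bdm psi -> (forall j, j \in l -> coord_free j psi) ->
    Ex (fun x => psi x * f x) = Ex (fun x => psi x * G l x).
  move=> bpsi; elim: l => // i l ih psifree.
  rewrite (Ex_free_mul indX _ bpsi (bG l)); last first.
    by apply: psifree; rewrite mem_head.
  by apply: ih => j jl; apply: psifree; rewrite inE jl orbT.
have bGr l t : bdm (fun x => G l x `^ t).
  exact: (bdm_powR_pos t c0 (cG l) (bG l)).
have freeR l t j : j \in l -> coord_free j (fun x => G l x `^ t).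
  by move=> jl x y; rewrite (Gfree l j jl).
have main l : Ex (fun x => W x `^ (s + 1)) - Ex (fun x => G l x `^ p) <=
    \sum_(i <- l) (Ex (fun x => W x `^ (s + 1)) - Ex (fun x => Ei i f x `^ p)).
  elim: l => [|i l ih].
    rewrite big_nil subr_le0; apply: Ex_le => [||x].
    + exact: (bdm_powR_pos _ eps0 epsW bW).
    + exact: bGr [::] p.
    + by rewrite /= -powRrM /p mulrDr mulr1 mulfV ?gt_eqF.
  rewrite big_cons; apply: (sub_telescope ih).
  apply: (gap_averaging (i := i) (bG l) (cG l)).
  - exact: (Gswap l _ (bGr l _) (fun j jl => freeR l _ j jl)).
  - apply: (Gswap l _ (bGr (i :: l) _)) => j jl.
    by apply: freeR; rewrite inE jl orbT.
have -> : Ex (fun x => W x `^ s) `^ p = Ex (fun x => G (enum 'I_n) x `^ p).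
  have Gc x y : G (enum 'I_n) x = G (enum 'I_n) y.
    by apply: coord_free_cst => i; apply: Gfree; rewrite mem_enum.
  have Gf : Ex f = Ex (G (enum 'I_n)).
    have := Gswap (enum 'I_n) (fun=> 1) (bdm_cst 1) (fun _ _ _ _ => erefl).
    by rewrite (Ex_Z X _ bf) (Ex_Z X _ (bG _)) !mul1r.
  have GE x : G (enum 'I_n) x = Ex f.
    by rewrite Gf -[LHS](Ex_cst X); apply: eq_Ex => y; exact: Gc.
  by rewrite -[LHS](Ex_cst X); apply: eq_Ex => x; rewrite GE.
by have := main (enum 'I_n); rewrite big_enum.
Qed.

End tensorization.

(** * Decoupling of independent increments *)

(** Every term except the one of the largest D_i has another term above it, so
    h(D_i) is at most h of the maximum of the others; the largest term is kept
    as it is. *)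
Lemma sum_sqr_le_max {R : realType} {n : nat} (D : 'I_n -> R) (h : R -> R) :
  (forall i, 0 <= D i) -> (forall a : R, 0 <= a -> 0 <= h a) ->
  (forall a b : R, 0 <= a -> a <= b -> h a <= h b) ->
  \sum_i D i ^+ 2 * h (D i) <=
  \sum_i D i ^+ 2 * h (\big[Num.max/0]_(j | j != i) D j) +
  (\big[Num.max/0]_i D i) ^+ 2 * h (\big[Num.max/0]_i D i).
Proof.
move=> D0 h0 hmono; set M := \big[Num.max/0]_i D i.
have M0 : 0 <= M by exact: bigmax_ge_id.
have N0 i : 0 <= \big[Num.max/0]_(j | j != i) D j by exact: bigmax_ge_id.
have [i0 _|no] := pickP (@predT 'I_n); last first.
  rewrite !big1 ?add0r ?mulr_ge0 ?sqr_ge0 ?h0// => i _; by have := no i.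
have [k _ Mk] := @eq_bigmax _ R _ 0 i0 predT D isT (fun i _ => D0 i).
rewrite -/M in Mk; rewrite (bigD1 k)//= [in leRHS](bigD1 k)//= addrC.
rewrite -addrA [leRHS]addrC -addrA -Mk lerD//.
  apply: ler_sum => i ik; rewrite ler_wpM2l ?sqr_ge0// hmono//.
  apply: (@le_trans _ _ (D k)); first by rewrite -Mk; exact: le_bigmax.
  by apply: le_bigmax_cond; rewrite eq_sym.
by rewrite ler_wpDr// mulr_ge0 ?sqr_ge0 ?h0.
Qed.

Lemma bdm_bigmax {d : measure_display} {T : measurableType d} {R : realType}
    {I : Type} (s : seq I) (Q : pred I) (F : I -> T -> R) :
  (forall i, bdm (F i)) -> bdm (fun x => \big[Num.max/0]_(i <- s | Q i) F i x).
Proof.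
move=> bF; elim: s => [|i s ih].
  by under eq_fun do rewrite big_nil; exact: bdm_cst.
under eq_fun do rewrite big_cons.
by case: (Q i) => //; exact: bdm_max.
Qed.

Section decoupling.
Context {d d' : measure_display} {Om : measurableType d} {E : measurableType d'}.
Context {R : realType} {P : probability Om R} {n : nat}.
Variable X : 'I_n -> {RV P >-> E}.
Hypothesis indX : mutually_independent P X.
Local Notation Ex := (@tuple_mean _ _ _ _ R P n X).
Local Notation Ei := (@coord_mean _ _ _ _ R P n X).

Definition coord_max (D : 'I_n -> E -> R) (x : n.-tuple E) : R :=
  \big[Num.max/0]_i D i (tnth x i).

(** In sum_sqr_le_max, D_i is independent of the maximum of the others, so the
    mean of the product is a product of means. *)
Lemma decoupling (D : 'I_n -> E -> R) (h : R -> R) :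
  (forall i, bdm (D i)) -> (forall i y, 0 <= D i y) ->
  (forall a : R, 0 <= a -> 0 <= h a) ->
  (forall a b : R, 0 <= a -> a <= b -> h a <= h b) ->
  measurable_fun [set: R] h ->
  \sum_i 'EE_P (fun w => D i (X i w) ^+ 2 * h (D i (X i w))) <=
  (\sum_i 'EE_P (fun w => D i (X i w) ^+ 2)) *
    Ex (fun x => h (coord_max D x)) +
  Ex (fun x => coord_max D x ^+ 2 * h (coord_max D x)).
Proof.
move=> bD D0 h0 hmono mh; pose M := coord_max D.
have bD' i : bdm (fun x : n.-tuple E => D i (tnth x i)).
  by apply: bdm_comp (bD i); exact: measurable_tnth.
have bh (f : n.-tuple E -> R) : bdm f -> (forall x, 0 <= f x) ->
    bdm (fun x => h (f x)).
  move=> [mf [k fk]] f0; split; first exact: (measurableT_comp mh).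
  exists (h k) => x; rewrite ger0_norm ?h0//; apply: hmono => //.
  by rewrite (le_trans (ler_norm _)).
pose N i (x : n.-tuple E) := \big[Num.max/0]_(j | j != i) D j (tnth x j).
have bM : bdm M by exact: bdm_bigmax.
have bN i : bdm (N i) by exact: bdm_bigmax.
have M0 x : 0 <= M x by exact: bigmax_ge_id.
have N0 i x : 0 <= N i x by exact: bigmax_ge_id.
have bDh i := bh _ (bD' i) (fun x => D0 i (tnth x i)).
have bNh i := bh _ (bN i) (N0 i).
have bMh := bh _ bM M0.
have bD2 i := bdmX 2 (bD' i).
have toEx i (k : R -> R) : 'EE_P (fun w => k (D i (X i w))) =
    Ex (fun x => k (D i (tnth x i))).
  by apply: eq_bE => w; rewrite tnth_mktuple.
rewrite (eq_bigr (fun i => Ex (fun x => D i (tnth x i) ^+ 2 * h (D i (tnth x i)))));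
  last by move=> i _; exact: (toEx i (fun a => a ^+ 2 * h a)).
rewrite -/M -(Ex_sum X _ (fun i => bdmM (bD2 i) (bDh i))).
have bS : bdm (fun x : n.-tuple E => \sum_i D i (tnth x i) ^+ 2 * h (N i x)).
  by apply: bdm_sum => i; exact: bdmM (bD2 i) (bNh i).
have bMM := bdmM (bdmX 2 bM) bMh.
have H x := sum_sqr_le_max (fun i => D0 i (tnth x i)) h0 hmono.
apply: (le_trans (Ex_le X _ (bdmD bS bMM) H)).
  by apply: bdm_sum => i; exact: bdmM (bD2 i) (bDh i).
rewrite (Ex_D X bS bMM) lerD2r (Ex_sum X _ (fun i => bdmM (bD2 i) (bNh i))).
rewrite mulr_suml; apply: ler_sum => i _.
rewrite (toEx i (fun a => a ^+ 2)).
have freeN : coord_free i (fun x => h (N i x)).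
  move=> x y; congr h; apply: eq_bigr => j ji.
  by rewrite tnth_upd (negbTE ji).
have -> : Ex (fun x => D i (tnth x i) ^+ 2 * h (N i x)) =
    Ex (fun x => h (N i x) * (fun x => D i (tnth x i) ^+ 2) x).
  by apply: eq_Ex => x; rewrite mulrC.
rewrite -(Ex_free_mul indX freeN (bNh i) (bD2 i)).
have -> : Ex (fun x => h (N i x) * Ei i (fun x => D i (tnth x i) ^+ 2) x) =
    Ex (fun x => Ex (fun x => D i (tnth x i) ^+ 2) * h (N i x)).
  apply: eq_Ex => x; rewrite mulrC; congr (_ * _).
  rewrite -(toEx i (fun a => a ^+ 2)); apply: eq_bE => w.
  by rewrite tnth_upd eqxx.
rewrite (Ex_Z X _ (bNh i)); apply: ler_wpM2l.
  by apply: bE_ge0 => w; exact: sqr_ge0.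
apply: (Ex_le X (bNh i) bMh) => x; apply: hmono => //.
by apply: sub_bigmax.
Qed.

End decoupling.

(** * The entropy of one coordinate *)

Section exchange.
Context {d d' : measure_display} {Om : measurableType d} {E : measurableType d'}.
Context {R : realType} {P : probability Om R} {n : nat}.
Variable X : 'I_n -> {RV P >-> E}.
Hypothesis indX : mutually_independent P X.
Local Notation Ex := (@tuple_mean _ _ _ _ R P n X).
Local Notation Ei := (@coord_mean _ _ _ _ R P n X).

Lemma bdm_resample i (K : n.-tuple E * n.-tuple E -> R) : bdm K ->
  bdm (fun p : n.-tuple E * Om => K (p.1, upd p.1 i (X i p.2))).
Proof.
apply: bdm_comp; apply: measurable_fun_pair => //.
exact: measurable_upd_rv.
Qed.

(** X_i and its copy are exchangeable given the other coordinates. *)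
Lemma exchange_resample i (K : n.-tuple E * n.-tuple E -> R) : bdm K ->
  Ex (fun x => 'EE_P (fun w => K (x, upd x i (X i w)))) =
  Ex (fun x => 'EE_P (fun w => K (upd x i (X i w), x))).
Proof.
move=> bK.
have bKs : bdm (fun p => K (p.2, p.1)).
  by apply: (bdm_comp _ bK); exact: measurable_swap.
have b1 := bdm_EE X (bdm_resample i bK).
have b2 := bdm_EE X (bdm_resample i bKs).
rewrite -[LHS](Ex_Ei indX i b1) -[RHS](Ex_Ei indX i b2).
apply: eq_Ex => x.
have bG : bdm (fun p : Om * Om => K (upd x i (X i p.1), upd x i (X i p.2))).
  apply: (bdm_comp _ bK).
  have mu : measurable_fun [set: Om] (fun w => upd x i (X i w)).
    exact: (measurableT_comp (measurable_upd_rv X i) (measurable_pair1 x)).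
  apply: measurable_fun_pair.
    exact: (measurableT_comp mu).
  exact: (measurableT_comp mu).
rewrite /coord_mean.
transitivity ('EE_P (fun w1 => 'EE_P (fun w2 =>
    K (upd x i (X i w1), upd x i (X i w2))))).
  by apply: eq_bE => w1; apply: eq_bE => w2; rewrite /= upd_upd.
rewrite (bE_swap P P bG).
by apply: eq_bE => w1; apply: eq_bE => w2; rewrite /= upd_upd.
Qed.

End exchange.

(** The tangent inequality at b; the maximum restricts it to b >= a. *)
Lemma powR_increment {R : realType} (s a b : R) : 1 <= s -> 0 < a -> 0 < b ->
  (b `^ s - a `^ s) * Num.max (b - a) 0 <=
  s * (Num.max (b - a) 0 ^+ 2 * (a + Num.max (b - a) 0) `^ (s - 1)).
Proof.
move=> s1 a0 b0; have [ba|ab] := leP (b - a) 0.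
  by rewrite !mulr0 expr0n/= mul0r mulr0.
rewrite subrKC expr2 mulrA mulrCA mulrC -mulrA ler_wpM2l ?(ltW ab)//.
have := powR_tangent s1 (ltW a0) (ltW b0); lra.
Qed.

Section one_coordinate.
Context {d d' : measure_display} {Om : measurableType d} {E : measurableType d'}.
Context {R : realType} {P : probability Om R} {n : nat}.
Variable X : 'I_n -> {RV P >-> E}.
Hypothesis indX : mutually_independent P X.
Local Notation Ex := (@tuple_mean _ _ _ _ R P n X).
Local Notation Ei := (@coord_mean _ _ _ _ R P n X).
Variables (s : R) (W : n.-tuple E -> R) (eps : R).
Hypotheses (s1 : 1 <= s) (bW : bdm W) (eps0 : 0 < eps)
  (epsW : forall x, eps <= W x).
Let W0 x : 0 < W x. Proof. exact: lt_le_trans (epsW x). Qed.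
Let s0 : 0 < s. Proof. exact: lt_le_trans ltr01 s1. Qed.

(** Only increases of W, that is decreases of Z, are recorded: this is what
    makes V+ appear rather than the two-sided variance. *)
Definition incr (x : n.-tuple E) (i : 'I_n) (y : E) : R :=
  Num.max (W (upd x i y) - W x) 0.

(** By Jensen's inequality (E_i W^s)^(1 + 1/s) >= E_i W^s E_i W, because E_i
    W^s >= (E_i W)^s. The usual symmetrised bound for the entropy would lose a
    factor 1 + 1/s. *)
Lemma gap_le_covariance i :
  Ex (fun x => W x `^ (s + 1)) -
    Ex (fun x => Ei i (fun x => W x `^ s) x `^ (1 + s^-1)) <=
  Ex (fun x => W x `^ s * W x) -
    Ex (fun x => Ei i (fun x => W x `^ s) x * W x).
Proof.
have bWs := bdm_powR_pos s eps0 epsW bW.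
have bWr := bdm_powR_pos (s + 1) eps0 epsW bW.
set h := Ei i (fun x => W x `^ s).
have bh : bdm h by exact: bdm_Ei.
have cs x : eps `^ s <= W x `^ s by exact: le_powR (ltW s0) (ltW eps0) (epsW x).
have c0 : 0 < eps `^ s by rewrite powR_gt0.
have hc := Ei_ge X i bWs cs.
have h0 x : 0 < h x by exact: lt_le_trans (hc x).
have hfree : coord_free i h by exact: Ei_coord_free.
have -> : Ex (fun x => W x `^ (s + 1)) = Ex (fun x => W x `^ s * W x).
  apply: eq_Ex => x; rewrite powRD ?powRr1 ?ltW//.
  by apply/implyP => _; rewrite gt_eqF.
rewrite lerD2l lerN2 -(Ex_free_mul indX hfree bh bW).
have bhp := bdm_powR_pos (1 + s^-1) c0 hc bh.
apply: (Ex_le X (bdmM bh (bdm_Ei X i bW)) bhp) => x.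
rewrite -(root_mul s1 (h0 x)) mulrC ler_wpM2r ?(ltW (h0 x))//.
have W0' : 0 <= Ei i W x by apply: bE_ge0 => w; rewrite ltW.
have J := bE_jensen P s1 (bdm_upd X i x bW) (fun w => ltW (W0 _)).
have iV : 0 <= s^-1 by rewrite invr_ge0 ltW.
have := le_powR iV (powR_ge0 _ _) J.
by rewrite -powRrM (mulfV (lt0r_neq0 s0)) powRr1.
Qed.

(** The covariance is half the mean of (W'^s - W^s)(W' - W). Exchangeability
    turns this symmetric expression into the mean of its part with W' > W,
    without the factor 1/2. *)
Lemma gap_le_incr i :
  Ex (fun x => W x `^ (s + 1)) -
    Ex (fun x => Ei i (fun x => W x `^ s) x `^ (1 + s^-1)) <=
  s * Ex (fun x => 'EE_P (fun w =>
    incr x i (X i w) ^+ 2 * (W x + incr x i (X i w)) `^ (s - 1))).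
Proof.
apply: (le_trans (gap_le_covariance i)).
have bWs := bdm_powR_pos s eps0 epsW bW.
have bWW := bdmM bWs bW.
pose k (p : n.-tuple E * n.-tuple E) : R :=
  (W p.2 `^ s - W p.1 `^ s) * Num.max (W p.2 - W p.1) 0.
have bW1 : bdm (fun p : n.-tuple E * n.-tuple E => W p.1).
  by apply: (bdm_comp _ bW).
have bW2 : bdm (fun p : n.-tuple E * n.-tuple E => W p.2).
  by apply: (bdm_comp _ bW).
have bWs1 : bdm (fun p : n.-tuple E * n.-tuple E => W p.1 `^ s).
  by apply: (bdm_comp _ bWs).
have bWs2 : bdm (fun p : n.-tuple E * n.-tuple E => W p.2 `^ s).
  by apply: (bdm_comp _ bWs).
have bD : bdm (fun p : n.-tuple E * n.-tuple E => Num.max (W p.2 - W p.1) 0).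
  by apply: bdm_max; [exact: bdmB|exact: bdm_cst].
have bk : bdm k by exact: bdmM (bdmB bWs2 bWs1) bD.
have bks : bdm (fun p => k (p.2, p.1)).
  by apply: (bdm_comp _ bk); exact: measurable_swap.
have bkE := bdm_EE X (bdm_resample X i bk).
have bksE := bdm_EE X (bdm_resample X i bks).
pose h := Ei i (fun x => W x `^ s).
have bh : bdm h by exact: bdm_Ei.
pose m := Ei i W.
have bm : bdm m by exact: bdm_Ei.
pose e := Ei i (fun x => W x `^ s * W x).
have be : bdm e by exact: bdm_Ei.
have hfree : coord_free i h by exact: Ei_coord_free.
have mfree : coord_free i m by exact: Ei_coord_free.
(* k(x, x') + k(x', x) is the full product (W'^s - W^s)(W' - W) *)
have sym x : 'EE_P (fun w => k (x, upd x i (X i w))) +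
    'EE_P (fun w => k (upd x i (X i w), x)) =
    e x - h x * W x - m x * W x `^ s + W x `^ s * W x.
  have bu := bdm_upd X i x bW; have bus := bdm_upd X i x bWs.
  have buu := bdm_upd X i x bWW.
  rewrite -bE_D; last 2 first.
  - exact: (bdm_pairl x (bdm_resample X i bk)).
  - exact: (bdm_pairl x (bdm_resample X i bks)).
  transitivity ('EE_P (fun w => W (upd x i (X i w)) `^ s * W (upd x i (X i w))
      - W x * W (upd x i (X i w)) `^ s - W x `^ s * W (upd x i (X i w))
      + W x `^ s * W x)).
    apply: eq_bE => w; rewrite /k/=.
    set a := W _; set b := W x.
    have [ab|ab] := leP (a - b) 0; have [ba|ba] := leP (b - a) 0;
      rewrite ?mulr0; try ring.
    + have -> : a = b by apply/eqP; rewrite eq_le -subr_le0 ab -subr_le0 ba.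
      ring.
    + by have := addr_gt0 ab ba; rewrite subrKA subrr ltxx.
  rewrite bE_D; [|by do !apply: bdmB => //; exact: bdmZ|exact: bdm_cst].
  rewrite bE_B; [|by apply: bdmB => //; exact: bdmZ|exact: bdmZ].
  rewrite bE_B; [|exact: buu|exact: bdmZ].
  rewrite (bE_Z _ _ bus) (bE_Z _ _ bu) bE_cst.
  by rewrite mulrC [m x * _]mulrC.
have two : 2 * (Ex (fun x => W x `^ s * W x) - Ex (fun x => h x * W x)) =
    2 * Ex (fun x => 'EE_P (fun w => k (x, upd x i (X i w)))).
  have E2 := exchange_resample indX i bk.
  rewrite [RHS]mulr_natl [RHS]mulr2n.
  rewrite [X in _ = _ + X]E2 -(Ex_D X bkE bksE).
  rewrite (eq_Ex X sym).
  have bhW := bdmM bh bW; have bmW := bdmM bm bWs.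
  rewrite (Ex_D X (bdmB (bdmB be bhW) bmW) bWW) (Ex_B X (bdmB be bhW) bmW).
  rewrite (Ex_B X be bhW) (Ex_Ei indX i bWW).
  have -> : Ex (fun x => m x * W x `^ s) = Ex (fun x => h x * W x).
    rewrite -(Ex_free_mul indX mfree bm bWs) -(Ex_free_mul indX hfree bh bW).
    by apply: eq_Ex => x; rewrite mulrC.
  ring.
have -> : Ex (fun x => W x `^ s * W x) - Ex (fun x => h x * W x) =
    Ex (fun x => 'EE_P (fun w => k (x, upd x i (X i w)))).
  by apply: (mulfI (_ : 2 != 0 :> R)) => //; rewrite pnatr_eq0.
pose l (p : n.-tuple E * n.-tuple E) : R :=
  Num.max (W p.2 - W p.1) 0 ^+ 2 * (W p.1 + Num.max (W p.2 - W p.1) 0) `^ (s - 1).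
have bl : bdm l.
  apply: bdmM; first exact: bdmX.
  apply: bdm_powR; first by rewrite subr_ge0.
    by move=> p; rewrite addr_ge0 ?(ltW (W0 _))// le_max lexx orbT.
  exact: bdmD.
have bl' := bdm_resample X i bl.
have blE := bdm_EE X bl'.
rewrite -(Ex_Z X _ blE).
apply: (Ex_le X bkE (bdmZ s blE)) => x.
have bl2 := bdm_pairl x bl'.
rewrite -(bE_Z P s bl2); apply: bE_le.
- exact: (bdm_pairl x (bdm_resample X i bk)).
- exact: bdmZ.
by move=> w; exact: powR_increment.
Qed.

End one_coordinate.

(** * Moment recursions *)

Section moment_recursion.
Context {d d' : measure_display} {Om : measurableType d} {E : measurableType d'}.
Context {R : realType} {P : probability Om R} {n : nat}.
Variable X : 'I_n -> {RV P >-> E}.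
Hypothesis indX : mutually_independent P X.
Local Notation Ex := (@tuple_mean _ _ _ _ R P n X).
Local Notation Ei := (@coord_mean _ _ _ _ R P n X).
Variables (s : R) (W : n.-tuple E -> R) (eps : R).
Hypotheses (s1 : 1 <= s) (bW : bdm W) (eps0 : 0 < eps)
  (epsW : forall x, eps <= W x).
Let W0 x : 0 < W x. Proof. exact: lt_le_trans (epsW x). Qed.
Let s0 : 0 < s. Proof. exact: lt_le_trans ltr01 s1. Qed.

Lemma bdm_incr i : bdm (fun p : n.-tuple E * E => incr W p.1 i p.2).
Proof.
apply: bdm_max; last exact: bdm_cst.
apply: bdmB; first by apply: (bdm_comp _ bW); exact: measurable_upd.
exact: (bdm_comp _ bW).
Qed.

Lemma incr_ge0 x i y : 0 <= incr W x i y.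
Proof. by rewrite /incr le_max lexx orbT. Qed.

Definition max_incr (x y : n.-tuple E) : R := coord_max (incr W x) y.

(** For W = theta(F), at the point X this is at most V+. *)
Definition var_incr (x : n.-tuple E) : R :=
  \sum_i 'EE_P (fun w => incr W x i (X i w) ^+ 2).

Lemma max_incr_ge0 x y : 0 <= max_incr x y.
Proof. exact: bigmax_ge_id. Qed.

Lemma var_incr_ge0 x : 0 <= var_incr x.
Proof. by apply: sumr_ge0 => i _; apply: bE_ge0 => w; exact: sqr_ge0. Qed.

Lemma bdm_max_incr :
  bdm (fun p : n.-tuple E * n.-tuple E => max_incr p.1 p.2).
Proof.
apply: bdm_bigmax => i.
have -> : (fun p : n.-tuple E * n.-tuple E => incr W p.1 i (tnth p.2 i)) =
  (fun p => incr W p.1 i p.2) \o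
  (fun p : n.-tuple E * n.-tuple E => (p.1, tnth p.2 i)) by [].
apply: bdm_comp (bdm_incr i); apply: measurable_fun_pair => //.
exact: (measurableT_comp (measurable_tnth i)).
Qed.

Lemma bdm_incr_rv i : bdm (fun p : n.-tuple E * Om => incr W p.1 i (X i p.2)).
Proof.
have -> : (fun p : n.-tuple E * Om => incr W p.1 i (X i p.2)) =
  (fun p => incr W p.1 i p.2) \o
  (fun p : n.-tuple E * Om => (p.1, X i p.2)) by [].
apply: bdm_comp (bdm_incr i); apply: measurable_fun_pair => //.
exact: (measurableT_comp (measurable_funPT (X i))).
Qed.

Lemma bdm_var_incr : bdm var_incr.
Proof. by apply: bdm_sum => i; exact: (bdm_EE X (bdmX 2 (bdm_incr_rv i))). Qed.

(** The square of the largest increment is the price of decoupling. *)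
Definition incr_energy (t : R) (p : n.-tuple E * n.-tuple E) : R :=
  (var_incr p.1 + max_incr p.1 p.2 ^+ 2) * (W p.1 + max_incr p.1 p.2) `^ t.

Lemma bdm_incr_energy t : 0 <= t -> bdm (incr_energy t).
Proof.
move=> t0; apply: bdmM.
  apply: bdmD; last exact: bdmX bdm_max_incr.
  exact: (bdm_comp _ bdm_var_incr).
apply: bdm_powR => // [p|].
  by rewrite addr_ge0 ?max_incr_ge0// ltW.
by apply: bdmD; [exact: (bdm_comp _ bW)|exact: bdm_max_incr].
Qed.

Let tensor : Ex (fun x => W x `^ (s + 1)) <=
  Ex (fun x => W x `^ s) `^ (1 + s^-1) +
  \sum_i (Ex (fun x => W x `^ (s + 1)) -
    Ex (fun x => Ei i (fun x => W x `^ s) x `^ (1 + s^-1))).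
Proof.
rewrite -lerBlDl.
exact: (power_entropy_tensorization indX s1 bW eps0 epsW).
Qed.

Let bincr i : bdm (fun x => 'EE_P (fun w =>
    incr W x i (X i w) ^+ 2 * (W x + incr W x i (X i w)) `^ (s - 1))).
Proof.
apply: (bdm_EE X (G := fun p => incr W p.1 i (X i p.2) ^+ 2 *
  (W p.1 + incr W p.1 i (X i p.2)) `^ (s - 1))).
apply: bdmM; first exact: bdmX (bdm_incr_rv i).
apply: bdm_powR; first by rewrite subr_ge0.
  by move=> p; rewrite addr_ge0 ?incr_ge0// ltW.
by apply: bdmD; [exact: (bdm_comp _ bW)|exact: bdm_incr_rv].
Qed.

Let recursion_sum : Ex (fun x => W x `^ (s + 1)) <=
  Ex (fun x => W x `^ s) `^ (1 + s^-1) +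
  s * Ex (fun x => \sum_i 'EE_P (fun w =>
    incr W x i (X i w) ^+ 2 * (W x + incr W x i (X i w)) `^ (s - 1))).
Proof.
apply: (le_trans tensor); rewrite lerD2l (Ex_sum X _ bincr) mulr_sumr.
by apply: ler_sum => i _; exact: (gap_le_incr indX s1 bW eps0 epsW i).
Qed.

Lemma moment_recursion : Ex (fun x => W x `^ (s + 1)) <=
  Ex (fun x => W x `^ s) `^ (1 + s^-1) +
  s * Ex (fun x => Ex (fun y => incr_energy (s - 1) (x, y))).
Proof.
apply: (le_trans recursion_sum); rewrite lerD2l ler_wpM2l ?(ltW s0)//.
have s10 : 0 <= s - 1 by rewrite subr_ge0.
have bG := bdm_incr_energy s10.
have bGX : bdm (fun p : n.-tuple E * Om =>
    incr_energy (s - 1) (p.1, rv_tuple X p.2)).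
  apply: (bdm_comp _ bG); apply: measurable_fun_pair => //.
  exact: (measurableT_comp (measurable_rv_tuple X)).
apply: (Ex_le X (bdm_sum _ bincr) (bdm_EE X bGX)) => x.
pose h a := (W x + a) `^ (s - 1).
have bD i : bdm (incr W x i) by exact: (bdm_pairl x (bdm_incr i)).
have mh : measurable_fun [set: R] h.
  apply: (measurableT_comp (measurable_powR _)).
  by apply: measurable_funD => //; exact: measurable_cst.
have hmono (a b : R) : 0 <= a -> a <= b -> h a <= h b.
  by move=> a0 ab; apply: le_powR => //; rewrite ?lerD2l// addr_ge0// ltW.
apply: (le_trans (decoupling indX bD (incr_ge0 x) (fun a _ => powR_ge0 _ _)
  hmono mh)).
have bM : bdm (max_incr x) by exact: (bdm_pairl x bdm_max_incr).
have bh : bdm (fun y => h (max_incr x y)).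
  apply: bdm_powR => // [y|]; first by rewrite addr_ge0 ?max_incr_ge0// ltW.
  by apply: bdmD => //; exact: bdm_cst.
rewrite -/(var_incr x) -(Ex_Z X _ bh).
rewrite -(Ex_D X (bdmZ _ bh) (bdmM (bdmX 2 bM) bh)).
rewrite le_eqVlt; apply/orP; left; apply/eqP.
by apply: eq_bE => y; rewrite -mulrDl.
Qed.

(** The entropy is the infimum over constants of the mean Bregman divergence;
    here the constant is w^s, which is constant in the coordinate i. *)
Lemma gap_le_free i w : bdm w -> coord_free i w -> (forall x, eps <= w x) ->
  Ex (fun x => W x `^ (s + 1)) -
    Ex (fun x => Ei i (fun x => W x `^ s) x `^ (1 + s^-1)) <=
  Ex (fun x => W x `^ (s + 1) + s^-1 * w x `^ (s + 1)
    - (s + 1) / s * (w x * W x `^ s)).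
Proof.
move=> bw wi epsw.
have bWs := bdm_powR_pos s eps0 epsW bW.
have bWr := bdm_powR_pos (s + 1) eps0 epsW bW.
have bwr := bdm_powR_pos (s + 1) eps0 epsw bw.
set h := Ei i (fun x => W x `^ s).
have bh : bdm h by exact: bdm_Ei.
have cs x : eps `^ s <= W x `^ s by exact: le_powR (ltW s0) (ltW eps0) (epsW x).
have c0 : 0 < eps `^ s by rewrite powR_gt0.
have hc := Ei_ge X i bWs cs.
have bhp := bdm_powR_pos (1 + s^-1) c0 hc bh.
have b1 := bdmZ ((s + 1) / s) (bdmM bw bh).
have b2 := bdmZ s^-1 bwr.
have b3 := bdmZ ((s + 1) / s) (bdmM bw bWs).
have H x : (s + 1) / s * (w x * h x) - s^-1 * w x `^ (s + 1) <=
    h x `^ (1 + s^-1).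
  have w0 : 0 < w x by exact: lt_le_trans (epsw x).
  have h0 : 0 <= h x by apply: le_trans (hc x); exact: ltW.
  have p1 : 1 <= 1 + s^-1 by rewrite lerDl invr_ge0 ltW.
  have := powR_tangent p1 h0 (powR_ge0 (w x) s).
  rewrite addrAC subrr add0r -!powRrM mulrDr mulr1 (mulfV (lt0r_neq0 s0)).
  rewrite (powRr1 (ltW w0)); apply: le_trans.
  have -> : w x `^ (s + 1) = w x `^ s * w x.
    by rewrite powRD ?powRr1 ?(ltW w0)//; apply/implyP => _; rewrite gt_eqF.
  by rewrite le_eqVlt; apply/orP; left; apply/eqP; field; exact: lt0r_neq0.
have := Ex_le X (bdmB b1 b2) bhp H.
rewrite (Ex_B X b1 b2) (Ex_Z X _ (bdmM bw bh)) (Ex_free_mul indX wi bw bWs).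
rewrite (Ex_B X (bdmD bWr b2) b3) (Ex_D X bWr b2) (Ex_Z X _ (bdmM bw bWs)).
exact: sub_swap.
Qed.

Lemma moment_recursion_free (w : 'I_n -> n.-tuple E -> R) :
  (forall i, bdm (w i)) -> (forall i, coord_free i (w i)) ->
  (forall i x, eps <= w i x) ->
  (forall i, {ae P, forall z, W (rv_tuple X z) <= w i (rv_tuple X z)}) ->
  Ex (fun x => W x `^ (s + 1)) <=
  Ex (fun x => W x `^ s) `^ (1 + s^-1) +
  (s + 1) / 2 * Ex (fun x => (\sum_i (w i x - W x) ^+ 2) *
    (W x + \big[Num.max/0]_i (w i x - W x)) `^ (s - 1)).
Proof.
move=> bw wi epsw Ww; apply: (le_trans tensor); rewrite lerD2l.
have s10 : 0 <= s - 1 by rewrite subr_ge0.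
have sp : 0 <= (s + 1) / 2 by rewrite divr_ge0// addr_ge0// ltW.
have bM : bdm (fun x => \big[Num.max/0]_i (w i x - W x)).
  by apply: bdm_bigmax => i; exact: bdmB (bw i) bW.
have bP : bdm (fun x => (W x + \big[Num.max/0]_i (w i x - W x)) `^ (s - 1)).
  apply: bdm_powR => // [x|]; last exact: bdmD bW bM.
  by rewrite addr_ge0 ?(ltW (W0 x))//; exact: bigmax_ge_id.
have bD i : bdm (fun x => (w i x - W x) ^+ 2) by exact: bdmX (bdmB (bw i) bW).
have bS : bdm (fun x => \sum_i (w i x - W x) ^+ 2 *
    (W x + \big[Num.max/0]_i (w i x - W x)) `^ (s - 1)).
  by apply: bdm_sum => i; exact: bdmM (bD i) bP.
rewrite -(Ex_Z X _ (bdmM (bdm_sum _ bD) bP)).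
have -> : Ex (fun x => (s + 1) / 2 * ((\sum_i (w i x - W x) ^+ 2) *
    (W x + \big[Num.max/0]_i (w i x - W x)) `^ (s - 1))) =
  \sum_i Ex (fun x => (s + 1) / 2 * ((w i x - W x) ^+ 2 *
    (W x + \big[Num.max/0]_i (w i x - W x)) `^ (s - 1))).
  rewrite -(Ex_sum X _ (fun i => bdmZ ((s + 1) / 2) (bdmM (bD i) bP))).
  by apply: eq_Ex => x; rewrite mulr_suml mulr_sumr.
apply: ler_sum => i _; apply: (le_trans (gap_le_free (bw i) (wi i) (epsw i))).
have bWs := bdm_powR_pos s eps0 epsW bW.
have bWr := bdm_powR_pos (s + 1) eps0 epsW bW.
have bwr := bdm_powR_pos (s + 1) eps0 (epsw i) (bw i).
apply: bE_le_ae.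
- exact: (bdm_rv X (bdmB (bdmD bWr (bdmZ _ bwr)) (bdmZ _ (bdmM (bw i) bWs)))).
- exact: (bdm_rv X (bdmZ _ (bdmM (bD i) bP))).
apply: filterS (Ww i) => z; set x := rv_tuple X z => Wwx.
have r2 : 2 <= s + 1 by rewrite -(lerBlDr _ 1) -[_ - 1]/(2 - 1) addrK.
have := bregman_quadratic r2 (W0 x) Wwx.
have -> : s + 1 - 1 = s by rewrite addrK.
have -> : s + 1 - 2 = s - 1 by rewrite opprD addrACA subrr addr0.
rewrite -[(s + 1) / s * _ * _]mulrA; move=> /le_trans; apply.
rewrite [leRHS]mulrCA [leRHS]mulrC; apply: ler_wpM2r; first exact: sqr_ge0.
apply: ler_wpM2l => //; apply: le_powR => //.
  by apply: le_trans Wwx; exact: ltW.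
by rewrite -lerBlDl; exact: le_bigmax.
Qed.

End moment_recursion.

(** * Solution of the recursion *)

Section moment_induction.
Context {R : realType}.
Implicit Types (r x q : R).

(** If x exceeded sqrt(C r A), with kappa = sqrt C and alpha = sqrt A, the
    first term of the recursion would be at most e^(-1/2) x^r, by 1 - 1/r <=
    e^(-1/r), and the second at most e^(1/kappa) x^r / (a kappa^2). *)
Lemma moment_step (kappa alpha a r x m : R) :
  0 < kappa -> 0 < alpha -> 0 < a -> 2 <= r -> 0 < x ->
  expR (- 2^-1) + expR kappa^-1 / (a * kappa ^+ 2) < 1 ->
  0 <= m -> m <= (kappa * alpha * Num.sqrt (r - 1)) `^ (r - 1) ->
  x `^ r <= m `^ (r / (r - 1)) +
    r / a * alpha ^+ 2 * (x + alpha / Num.sqrt r) `^ (r - 2) ->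
  x <= kappa * alpha * Num.sqrt r.
Proof.
move=> k0 al0 a0 r2 x0 num m0 mle rec.
have r0 : 0 < r by lra.
have r10 : 0 < r - 1 by lra.
have sr0 : 0 < Num.sqrt r by rewrite sqrtr_gt0.
rewrite leNgt; apply/negP => Bx.
set B := kappa * alpha * Num.sqrt r in Bx.
have B0 : 0 < B by rewrite !mulr_gt0.
have xr0 : 0 < x `^ r by rewrite powR_gt0.
(* sqrt(1 - 1/r) <= exp(-1 / (2 r)), then take the power r *)
have h1 : m `^ (r / (r - 1)) <= expR (- 2^-1) * x `^ r.
  have rr : 0 <= r / (r - 1) by rewrite divr_ge0 ?ltW.
  apply: (le_trans (le_powR rr m0 mle)).
  rewrite -powRrM (_ : (r - 1) * (r / (r - 1)) = r); last first.
    by field; rewrite gt_eqF.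
  have e : Num.sqrt (r - 1) <= expR (- (2 * r)^-1) * Num.sqrt r.
    rewrite -[leRHS]ger0_norm ?mulr_ge0 ?expR_ge0 ?sqrtr_ge0//.
    rewrite -sqrtr_sqr ler_wsqrtr// exprMn sqr_sqrtr ?(ltW r0)//.
    rewrite -expRM_natl (_ : 2 * - (2 * r)^-1 = - r^-1); last first.
      by field; rewrite gt_eqF.
    have := expR_ge1Dx (- r^-1); rewrite -(ler_pM2r r0) mulrDl mul1r mulNr.
    by rewrite mulVf ?gt_eqF.
  have e2 : kappa * alpha * Num.sqrt (r - 1) <= expR (- (2 * r)^-1) * x.
    apply: (@le_trans _ _ (expR (- (2 * r)^-1) * B)).
      by rewrite /B mulrCA ler_wpM2l// mulr_ge0 ?ltW.
    by rewrite ler_wpM2l ?expR_ge0// ltW.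
  have := le_powR (ltW r0) _ e2.
  rewrite (powRM _ (expR_ge0 _) (ltW x0)) -expRM.
  rewrite (_ : - (2 * r)^-1 * r = - 2^-1); last by field; rewrite gt_eqF.
  by apply; rewrite !mulr_ge0 ?sqrtr_ge0 ?ltW.
have h2 : r / a * alpha ^+ 2 * (x + alpha / Num.sqrt r) `^ (r - 2) <=
    expR kappa^-1 / (a * kappa ^+ 2) * x `^ r.
  have sq : Num.sqrt r ^+ 2 = r by rewrite sqr_sqrtr ?ltW.
  have f1 : r * alpha ^+ 2 <= x ^+ 2 / kappa ^+ 2.
    rewrite ler_pdivlMr ?exprn_gt0//.
    have -> : r * alpha ^+ 2 * kappa ^+ 2 = B ^+ 2.
      by rewrite /B !exprMn sq; ring.
    by rewrite lerXn2r ?nnegrE ?ltW.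
  have f2 : x + alpha / Num.sqrt r <= x * expR (kappa^-1 / r).
    apply: (@le_trans _ _ (x * (1 + kappa^-1 / r))).
      rewrite mulrDr mulr1 lerD2l mulrA ler_pdivlMr//.
      rewrite -[X in _ * X]sq expr2 mulrA divfK ?gt_eqF//.
      rewrite ler_pdivlMr// (_ : _ * kappa = B) ?(ltW Bx)//.
      by rewrite /B; ring.
    by rewrite ler_wpM2l ?(ltW x0)// expR_ge1Dx.
  have r20 : 0 <= r - 2 by lra.
  have f3 : (x + alpha / Num.sqrt r) `^ (r - 2) <= x `^ (r - 2) * expR kappa^-1.
    apply: (le_trans (le_powR r20 _ f2)).
      by rewrite addr_ge0 ?(ltW x0)// divr_ge0 ?ltW.
    rewrite (powRM _ (ltW x0) (expR_ge0 _)) ler_wpM2l ?powR_ge0//.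
    rewrite -expRM ler_expR -mulrA ler_piMr ?invr_ge0 ?(ltW k0)//.
    by rewrite mulrC ler_pdivrMr// mul1r; lra.
  have xr : x `^ r = x ^+ 2 * x `^ (r - 2).
    rewrite -powR_mulrn ?(ltW x0)// -powRD; last first.
      by apply/implyP => _; rewrite gt_eqF.
    by congr (_ `^ _); lra.
  have -> : r / a * alpha ^+ 2 = r * alpha ^+ 2 / a by ring.
  have := ler_pM _ (powR_ge0 _ _) f1 f3.
  rewrite mulr_ge0 ?(ltW r0) ?sqr_ge0// => /(_ isT) h.
  have ia0 : 0 <= a^-1 by rewrite invr_ge0 ltW.
  have := ler_wpM2l ia0 h.
  rewrite mulrA [a^-1 * _]mulrC => /le_trans; apply.
  rewrite xr le_eqVlt; apply/orP; left; apply/eqP; field.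
  by rewrite !gt_eqF.
have := le_trans rec (lerD h1 h2); rewrite -mulrDl -[leLHS]mul1r.
by rewrite (ler_pM2r xr0) leNgt num.
Qed.

(** Induction from r - 1 to r, starting from the exponents between 1 and 2. *)
Lemma moment_induction (kappa alpha a q : R) (m : R -> R) :
  3 / 2 <= kappa -> 0 < alpha -> 0 < a ->
  expR (- 2^-1) + expR kappa^-1 / (a * kappa ^+ 2) < 1 ->
  (forall r, 0 < m r) ->
  (forall r, 1 <= r <= 2 -> m r <= (3 / 2 * alpha) `^ r) ->
  (forall r x, 2 <= r <= q -> 0 < x -> m r <= x `^ r ->
    m r <= m (r - 1) `^ (r / (r - 1)) +
    r / a * alpha ^+ 2 * (x + alpha / Num.sqrt r) `^ (r - 2)) ->
  forall r, 1 <= r <= q -> m r <= (kappa * alpha * Num.sqrt r) `^ r.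
Proof.
move=> k32 al0 a0 num m0 base rec.
have k0 : 0 < kappa by lra.
suff H (N : nat) r : 1 <= r <= q -> r <= N%:R + 2 ->
    m r <= (kappa * alpha * Num.sqrt r) `^ r.
  move=> r rq; apply: (H (Num.Def.truncn r)) => //.
  have /truncn_itv/andP[_ h] : 0 <= r by lra.
  by apply: (le_trans (ltW h)); rewrite -natr1; lra.
elim: N r => [|N ih] r /andP[r1 rq] rN; have [r2|r2] := leP r 2.
- have sr1 : 1 <= Num.sqrt r by rewrite -[leLHS]sqrtr1 ler_wsqrtr.
  apply: (le_trans (base r _)); first by rewrite r1.
  apply: le_powR; first by lra.
    by rewrite mulr_ge0// ltW.
  rewrite -[leLHS]mulr1; apply: ler_pM => //; first by rewrite mulr_ge0// ltW.
  by rewrite ler_wpM2r// ltW.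
- lra.
- have sr1 : 1 <= Num.sqrt r by rewrite -[leLHS]sqrtr1 ler_wsqrtr.
  apply: (le_trans (base r _)); first by rewrite r1.
  apply: le_powR; first by lra.
    by rewrite mulr_ge0// ltW.
  rewrite -[leLHS]mulr1; apply: ler_pM => //; first by rewrite mulr_ge0// ltW.
  by rewrite ler_wpM2r// ltW.
have r0 : 0 < r by lra.
have ihr : m (r - 1) <= (kappa * alpha * Num.sqrt (r - 1)) `^ (r - 1).
  by apply: ih; [lra|move: rN; rewrite -natr1; lra].
have x0 : 0 < m r `^ r^-1 by rewrite powR_gt0.
have xr : (m r `^ r^-1) `^ r = m r.
  by rewrite -powRrM mulVf ?gt_eqF// powRr1// ltW.
have := rec r (m r `^ r^-1) _ x0 _; rewrite xr lexx (ltW r2) rq => /(_ isT isT) h.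
rewrite -{1}xr; apply: le_powR; rewrite ?(ltW r0) ?(ltW x0)//.
apply: (moment_step k0 al0 a0 (ltW r2) x0 num (ltW (m0 (r - 1))) ihr).
by rewrite xr.
Qed.

End moment_induction.

(** * Numerical constants *)

Section numerics.
Context {R : realType}.
Implicit Types (x : R).

(** The inequality holds for all real x because the cubic remainder has a
    derivative of the sign of x. At negative x it gives the upper bounds on the
    exponential that the constants need. *)
Lemma expR_ge_cubic x : 1 + x + x ^+ 2 / 2 + x ^+ 3 / 6 <= expR x.
Proof.
pose g z : R := expR z - (1 + z + z ^+ 2 / 2).
have dg (z : R) : is_derive z 1 g (expR z - (1 + z)).
  by apply: is_derive_eq; rewrite /GRing.scale/=; field.
have g0 : g 0 = 0 by rewrite /g expR0 expr0n/= mul0r !addr0 subrr.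
have dg0 (z : R) : 0 <= expR z - (1 + z) by rewrite subr_ge0 expR_ge1Dx.
pose f z : R := expR z - (1 + z + z ^+ 2 / 2 + z ^+ 3 / 6).
have df (z : R) : is_derive z 1 f (g z).
  by apply: is_derive_eq; rewrite /GRing.scale/= /g; field.
have f0 : f 0 = 0 by rewrite /f expR0 !expr0n/= !mul0r !addr0 subrr.
rewrite -subr_ge0 -/(f x) -f0.
have [x0|/ltW x0] := leP 0 x.
  apply: (@le_of_derive_ge0 _ f g) => // z /andP[z0 _]; rewrite -g0.
  exact: (@le_of_derive_ge0 _ g (fun z => expR z - (1 + z))).
apply: (@le_of_derive_le0 _ f g) => // z /andP[_ z0]; rewrite -g0.
exact: (@le_of_derive_ge0 _ g (fun z => expR z - (1 + z))).
Qed.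

Lemma expR_ge_quartic_power (x c : R) :
  0 <= 1 + x + x ^+ 2 / 2 + x ^+ 3 / 6 ->
  c <= (1 + x + x ^+ 2 / 2 + x ^+ 3 / 6) ^+ 4 -> c <= expR (4 * x).
Proof.
move=> x0 /le_trans; apply; rewrite expRM_natl.
by rewrite lerXn2r ?nnegrE ?expR_ge0//; exact: expR_ge_cubic.
Qed.

Lemma expRN_mul_le (x c : R) : c <= expR (- x) -> expR x * c <= 1.
Proof.
by move=> h; rewrite -(expRxMexpNx_1 x); apply: ler_wpM2l => //; exact: expR_ge0.
Qed.

Lemma expR_Nhalf_le : expR (- 2^-1) * (61 / 37) <= 1 :> R.
Proof.
apply: expRN_mul_le; rewrite opprK.
rewrite [X in expR X](_ : _ = 4 * (1 / 8)); last by lra.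
by apply: expR_ge_quartic_power; lra.
Qed.

Lemma constant_incr : expR (- 2^-1) + expR (53 / 26)^-1
  / (1 * (53 / 26) ^+ 2) < 1 :> R.
Proof.
have e : expR (26 / 53) * (153 / 250) <= 1 :> R.
  apply: expRN_mul_le.
  rewrite [X in expR X](_ : _ = 4 * (- (13 / 106))); last by lra.
  by apply: expR_ge_quartic_power; lra.
have := expR_Nhalf_le; rewrite invf_div.
move: e; move: (expR _) (expR _) => u v; lra.
Qed.

Lemma constant_free : expR (- 2^-1) + expR (14 / 9)^-1
  / (2 * (14 / 9) ^+ 2) < 1 :> R.
Proof.
have e : expR (9 / 14) * (41 / 78) <= 1 :> R.
  apply: expRN_mul_le.
  rewrite [X in expR X](_ : _ = 4 * (- (9 / 56))); last by lra.
  by apply: expR_ge_quartic_power; lra.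
have := expR_Nhalf_le; rewrite invf_div.
move: e; move: (expR _) (expR _) => u v; lra.
Qed.

End numerics.

(** * Moments of bounded functions *)

Lemma bE_lyapunov {d : measure_display} {T : measurableType d} {R : realType}
    (P : probability T R) (f : T -> R) (r q c : R) :
  0 < r -> r <= q -> 0 <= c -> bdm f -> (forall x, 0 <= f x) ->
  'EE_P (fun x => f x `^ q) <= c `^ q -> 'EE_P (fun x => f x `^ r) <= c `^ r.
Proof.
move=> r0 rq c0 bf f0 fq.
have q0 : 0 < q by exact: lt_le_trans rq.
have qr1 : 1 <= q / r by rewrite ler_pdivlMr// mul1r.
have bfr := bdm_powR (ltW r0) f0 bf.
have J := bE_jensen P qr1 bfr (fun x => powR_ge0 _ _).
have E0 : 0 <= 'EE_P (fun x => f x `^ r) by apply: bE_ge0 => x; exact: powR_ge0.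
have J' : 'EE_P (fun x => f x `^ r) `^ (q / r) <= c `^ q.
  apply: le_trans fq; apply: (le_trans J); rewrite le_eqVlt.
  apply/orP; left; apply/eqP; apply: eq_bE => x.
  by rewrite -powRrM mulrC divfK// gt_eqF.
have rq0 : 0 <= r / q by rewrite divr_ge0 ?(ltW r0) ?(ltW q0).
have := le_powR rq0 (powR_ge0 _ _) J'.
rewrite -!powRrM (_ : q / r * (r / q) = 1); last first.
  by field; rewrite !gt_eqF.
rewrite (_ : q * (r / q) = r); last by field; rewrite gt_eqF.
by rewrite powRr1.
Qed.

Section scalar.
Context {R : realType}.
Implicit Types (r q : R).

Lemma conjugate_exponents r : 2 <= r ->
  [/\ 0 < r, 1 <= r, 1 <= r - 1 & 1 <= r / 2] /\
  [/\ r - 1 + 1 = r, 1 + (r - 1)^-1 = r / (r - 1) & r - 1 - 1 = r - 2].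
Proof.
move=> r2; split; split; try lra.
by field; rewrite gt_eqF//; lra.
Qed.

Lemma div_sqrt_le (a r q : R) : 0 <= a -> 0 < r -> r <= q ->
  a / Num.sqrt q <= a / Num.sqrt r.
Proof.
move=> a0 r0 rq; rewrite ler_wpM2l// lef_pV2 ?posrE ?sqrtr_gt0//.
  exact: ler_wsqrtr.
exact: lt_le_trans rq.
Qed.

(** The factor r - 1 of the recursion absorbs the factor 1 + 1/r of the
    decoupling. *)
Lemma exponent_gain (r u v : R) : 2 <= r -> 0 <= u -> 0 <= v ->
  (r - 1) * ((u + u / r) * v) <= r / 1 * u * v.
Proof.
move=> r2 u0 v0.
rewrite divr1 !mulrA ler_wpM2r// -[u / r]mulrC -{1}[u]mul1r -mulrDl mulrA.
rewrite ler_wpM2r//.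
have r0 : 0 < r by lra.
have : 0 <= r^-1 by rewrite invr_ge0 ltW.
have : r * r^-1 = 1 by rewrite mulfV// gt_eqF.
by move: (r^-1) => i; lra.
Qed.

End scalar.

Section moment_bounds.
Context {d d' : measure_display} {Om : measurableType d} {E : measurableType d'}.
Context {R : realType} {P : probability Om R} {n : nat}.
Variable X : 'I_n -> {RV P >-> E}.
Hypothesis indX : mutually_independent P X.
Local Notation Ex := (@tuple_mean _ _ _ _ R P n X).
Variables (W : n.-tuple E -> R) (eps alpha q : R).
Hypotheses (bW : bdm W) (eps0 : 0 < eps) (epsW : forall x, eps <= W x).
Hypotheses (al0 : 0 < alpha) (q2 : 2 <= q).
Let W0 x : 0 < W x. Proof. exact: lt_le_trans (epsW x). Qed.

Hypothesis W2 : Ex (fun x => W x `^ 2) <= (3 / 2 * alpha) `^ 2.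

Let base r : 1 <= r <= 2 -> Ex (fun x => W x `^ r) <= (3 / 2 * alpha) `^ r.
Proof.
move=> /andP[r1 r2].
have r0 : 0 < r by exact: lt_le_trans ltr01 r1.
have c0 : 0 <= 3 / 2 * alpha by rewrite mulr_ge0// ltW.
by apply: (bE_lyapunov r0 r2 c0 (bdm_rv X bW)) => // w; exact: ltW.
Qed.

Let m0 r : 0 < Ex (fun x => W x `^ r).
Proof.
have [k Wk] := bW.2.
have bWr := bdm_powR_pos r eps0 epsW bW.
apply: (@bE_gt0 _ _ _ P (Num.min (eps `^ r) (k `^ r))
  (fun w => W (rv_tuple X w) `^ r)).
- rewrite lt_min !powR_gt0//.
  apply: lt_le_trans (Wk (rv_tuple X point)).
  by rewrite normr_gt0 gt_eqF.
- exact: (bdm_rv X bWr).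
- move=> w; rewrite ge_min; have [r0|/ltW r0] := leP 0 r.
    by rewrite le_powR// ltW.
  apply/orP; right; rewrite -[r]opprK !(powRN _ (- r)).
  have Wkx : W (rv_tuple X w) <= k by rewrite (le_trans (ler_norm _)).
  have k0 : 0 < k by apply: lt_le_trans Wkx.
  rewrite lef_pV2 ?posrE ?powR_gt0//.
  by apply: le_powR => //; rewrite ?oppr_ge0// ltW.
Qed.

(** In the recursion the norm of var_incr + max_incr^2 is at most alpha^2 (1 +
    1/r); the factor is absorbed by exponent_gain. *)
Lemma moment_bound_incr :
  Ex (fun x => var_incr X W x `^ (q / 2)) <= (alpha ^+ 2) `^ (q / 2) ->
  Ex (fun x => Ex (fun y => max_incr W x y `^ q)) <= (alpha / Num.sqrt q) `^ q ->
  Ex (fun x => W x `^ q) <= (53 / 26 * alpha * Num.sqrt q) `^ q.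
Proof.
move=> hv hM.
have q1 : 1 <= q <= q by rewrite lexx andbT; apply: le_trans q2; rewrite ler1n.
apply: (moment_induction (m := fun r => Ex (fun x => W x `^ r)) (a := 1)
  _ al0 ltr01 (@constant_incr R) m0 base _ q1); first by lra.
move=> r x /andP[r2 rq] x0 Wr.
have [[r0 r1 s1 r21] [e1 e2 e3]] := conjugate_exponents r2.
have := moment_recursion indX s1 bW eps0 epsW; rewrite e1 e2 e3.
move=> /le_trans; apply; rewrite lerD2l.
(* two independent draws of X live on the product space *)
pose PP : probability (Om * Om)%type R := (P \x P)%E.
pose v (p : Om * Om) := var_incr X W (rv_tuple X p.1).
pose M (p : Om * Om) := max_incr W (rv_tuple X p.1) (rv_tuple X p.2).
pose U (p : Om * Om) := W (rv_tuple X p.1).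
have mX1 : measurable_fun [set: Om * Om] (fun p => rv_tuple X p.1).
  exact: (measurableT_comp (measurable_rv_tuple X)).
have mX2 : measurable_fun [set: Om * Om] (fun p => rv_tuple X p.2).
  exact: (measurableT_comp (measurable_rv_tuple X)).
have bv : bdm v by exact: (bdm_comp mX1 (bdm_var_incr X bW)).
have bU : bdm U by exact: (bdm_comp mX1 bW).
have bM : bdm M.
  have -> : M = (fun p => max_incr W p.1 p.2) \o
    (fun p : Om * Om => (rv_tuple X p.1, rv_tuple X p.2)) by [].
  by apply: (bdm_comp _ (bdm_max_incr bW)); exact: measurable_fun_pair.
have v0 p : 0 <= v p by exact: var_incr_ge0.
have M0 p : 0 <= M p by exact: max_incr_ge0.
have U0 p : 0 <= U p by exact: ltW (W0 _).
have bM2 := bdmX 2 bM.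
have M20 p : 0 <= M p ^+ 2 by exact: sqr_ge0.
have bvM := bdmD bv bM2; have bUM := bdmD bU bM.
have vM0 p : 0 <= v p + M p ^+ 2 by rewrite addr_ge0.
have UM0 p : 0 <= U p + M p by rewrite addr_ge0.
have r22 : 0 <= r - 2 by rewrite subr_ge0.
have -> : Ex (fun x => Ex (fun y => incr_energy X W (r - 2) (x, y))) =
    'EE_PP (fun p => (v p + M p ^+ 2) * (U p + M p) `^ (r - 2)).
  by rewrite bE_prod//; exact: bdmM bvM (bdm_powR r22 UM0 bUM).
have marg (f : n.-tuple E -> R) : bdm f ->
    'EE_PP (fun p => f (rv_tuple X p.1)) = Ex f.
  move=> bf; rewrite bE_prod; last exact: (bdm_comp mX1 bf).
  by apply: eq_bE => w; exact: (bE_cst P (f (rv_tuple X w))).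
have a20 : 0 < alpha ^+ 2 by rewrite exprn_gt0.
have ar0 : 0 < alpha ^+ 2 / r by rewrite divr_gt0.
have q0 : 0 < q by exact: lt_le_trans rq.
have sr0 : 0 < alpha / Num.sqrt r by rewrite divr_gt0// sqrtr_gt0.
have sq0 : 0 < alpha / Num.sqrt q by rewrite divr_gt0// sqrtr_gt0.
have vr : 'EE_PP (fun p => v p `^ (r / 2)) <= (alpha ^+ 2) `^ (r / 2).
  have r20 : 0 < r / 2 by rewrite divr_gt0.
  have rq2 : r / 2 <= q / 2 by rewrite ler_wpM2r// invr_ge0.
  apply: (bE_lyapunov r20 rq2 (ltW a20) bv v0).
  have q20 : 0 <= q / 2 by rewrite divr_ge0// ltW.
  have bvq := bdm_powR q20 (var_incr_ge0 X W) (bdm_var_incr X bW).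
  by rewrite (marg _ bvq).
have Mr : 'EE_PP (fun p => M p `^ r) <= (alpha / Num.sqrt r) `^ r.
  apply: (@le_trans _ _ ((alpha / Num.sqrt q) `^ r)).
    apply: (bE_lyapunov r0 rq (ltW sq0) bM M0).
    by rewrite bE_prod//; exact: (bdm_powR (ltW q0) M0 bM).
  apply: (le_powR (ltW r0) (ltW sq0)).
  exact: (div_sqrt_le (ltW al0) r0 rq).
have M2r : 'EE_PP (fun p => (M p ^+ 2) `^ (r / 2)) <= (alpha ^+ 2 / r) `^ (r / 2).
  have sq z : 0 <= z -> (z ^+ 2) `^ (r / 2) = z `^ r.
    by move=> z0; rewrite -powR_mulrn// -powRrM mulrC divfK.
  have -> : alpha ^+ 2 / r = (alpha / Num.sqrt r) ^+ 2.
    by rewrite expr_div_n sqr_sqrtr ?ltW.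
  rewrite (sq _ (ltW sr0)); apply: le_trans Mr.
  by rewrite le_eqVlt; apply/orP; left; apply/eqP; apply: eq_bE => p; rewrite sq.
have Ur : 'EE_PP (fun p => U p `^ r) <= x `^ r.
  have bWr := bdm_powR_pos r eps0 epsW bW.
  by rewrite (marg _ bWr).
have h1 := bE_minkowski r21 bv bM2 v0 M20 a20 ar0 vr M2r.
have h2 := bE_minkowski r1 bU bM U0 M0 x0 sr0 Ur Mr.
have h3 := bE_holder r2 bvM bUM vM0 UM0 (addr_gt0 a20 ar0) (addr_gt0 x0 sr0)
  h1 h2.
have s0 : 0 <= r - 1 by exact: le_trans ler01 s1.
apply: (le_trans (ler_wpM2l s0 h3)).
exact: (exponent_gain r2 (ltW a20) (powR_ge0 _ _)).
Qed.

Lemma moment_bound_free (w : 'I_n -> n.-tuple E -> R) :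
  (forall i, bdm (w i)) -> (forall i, coord_free i (w i)) ->
  (forall i x, eps <= w i x) ->
  (forall i, {ae P, forall z, W (rv_tuple X z) <= w i (rv_tuple X z)}) ->
  Ex (fun x => (\sum_i (w i x - W x) ^+ 2) `^ (q / 2)) <=
    (alpha ^+ 2) `^ (q / 2) ->
  Ex (fun x => (\big[Num.max/0]_i (w i x - W x)) `^ q) <=
    (alpha / Num.sqrt q) `^ q ->
  Ex (fun x => W x `^ q) <= (14 / 9 * alpha * Num.sqrt q) `^ q.
Proof.
move=> bw wi epsw Ww hv hM.
have q1 : 1 <= q <= q by rewrite lexx andbT; apply: le_trans q2; rewrite ler1n.
apply: (moment_induction (m := fun r => Ex (fun x => W x `^ r)) (a := 2)
  _ al0 _ (@constant_free R) m0 base _ q1); [by lra|by []|].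
move=> r x /andP[r2 rq] x0 Wr.
have [[r0 r1 s1 r21] [e1 e2 e3]] := conjugate_exponents r2.
have := moment_recursion_free indX s1 bW eps0 epsW bw wi epsw Ww.
rewrite e1 e2 e3 => /le_trans; apply; rewrite lerD2l.
pose V x := \sum_i (w i x - W x) ^+ 2.
pose M x := \big[Num.max/0]_i (w i x - W x).
have bV : bdm V by apply: bdm_sum => i; exact: bdmX (bdmB (bw i) bW).
have bM : bdm M by apply: bdm_bigmax => i; exact: bdmB (bw i) bW.
have V0 y : 0 <= V y by apply: sumr_ge0 => i _; exact: sqr_ge0.
have M0 y : 0 <= M y by exact: bigmax_ge_id.
have WM0 y : 0 <= W y + M y by rewrite addr_ge0// ltW.
have q0 : 0 < q by exact: lt_le_trans rq.
have a20 : 0 < alpha ^+ 2 by rewrite exprn_gt0.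
have sr0 : 0 < alpha / Num.sqrt r by rewrite divr_gt0// sqrtr_gt0.
have sq0 : 0 < alpha / Num.sqrt q by rewrite divr_gt0// sqrtr_gt0.
have r20 : 0 < r / 2 by rewrite divr_gt0.
have rq2 : r / 2 <= q / 2 by rewrite ler_wpM2r// invr_ge0.
have bVX := bdm_rv X bV; have bMX := bdm_rv X bM; have bWX := bdm_rv X bW.
have hVr := bE_lyapunov r20 rq2 (ltW a20) bVX (fun _ => V0 _) hv.
have hMr := bE_lyapunov r0 rq (ltW sq0) bMX (fun _ => M0 _) hM.
have hMr' := le_trans hMr (le_powR (ltW r0) (ltW sq0)
  (div_sqrt_le (ltW al0) r0 rq)).
have h2 := bE_minkowski r1 bWX bMX (fun _ => ltW (W0 _)) (fun _ => M0 _)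
  x0 sr0 Wr hMr'.
have h3 := bE_holder r2 bVX (bdmD bWX bMX) (fun _ => V0 _) (fun _ => WM0 _) a20
  (addr_gt0 x0 sr0) hVr h2.
by rewrite -[leRHS]mulrA; exact: (ler_wpM2l (ltW r20) h3).
Qed.

End moment_bounds.

Section second_moment.
Context {d d' : measure_display} {Om : measurableType d} {E : measurableType d'}.
Context {R : realType} {P : probability Om R} {n : nat}.
Variable X : 'I_n -> {RV P >-> E}.
Hypothesis indX : mutually_independent P X.
Local Notation Ex := (@tuple_mean _ _ _ _ R P n X).
Variables (W : n.-tuple E -> R) (eps alpha q : R).
Hypotheses (bW : bdm W) (eps0 : 0 < eps) (epsW : forall x, eps <= W x).
Hypotheses (al0 : 0 < alpha) (q2 : 2 <= q).
Let W0 x : 0 < W x. Proof. exact: lt_le_trans (epsW x). Qed.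

Let toP1 : Ex (fun x => W x `^ 1) `^ (1 + 1^-1) = Ex W ^+ 2.
Proof.
have -> : Ex (fun x => W x `^ 1) = Ex W.
  by apply: eq_Ex => x; rewrite powRr1// ltW.
rewrite invr1 -[1 + 1]/(2%:R) powR_mulrn//.
by apply: bE_ge0 => w; exact: ltW.
Qed.

(** The recursion at r = 2, where incr_energy no longer depends on W. *)
Lemma second_moment_incr :
  Ex (fun x => var_incr X W x `^ (q / 2)) <= (alpha ^+ 2) `^ (q / 2) ->
  Ex (fun x => Ex (fun y => max_incr W x y `^ q)) <= (alpha / Num.sqrt q) `^ q ->
  Ex (fun x => W x `^ 2) <= Ex W ^+ 2 + 3 / 2 * alpha ^+ 2.
Proof.
move=> hv hM.
have q0 : 0 < q by exact: lt_le_trans q2.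
have a20 : 0 < alpha ^+ 2 by rewrite exprn_gt0.
have bv := bdm_var_incr X bW; have bM := bdm_max_incr bW.
have bM2 := bdmX 2 bM.
have bMX : bdm (fun p : n.-tuple E * Om => max_incr W p.1 (rv_tuple X p.2)).
  have mh : measurable_fun [set: n.-tuple E * Om]
      (fun p => (p.1, rv_tuple X p.2)).
    apply: measurable_fun_pair => //.
    exact: (measurableT_comp (measurable_rv_tuple X)).
  exact: (bdm_comp mh bM).
have := moment_recursion indX (lexx 1) bW eps0 epsW.
rewrite toP1 mul1r subrr -[1 + 1]/(2%:R) => /le_trans; apply; rewrite lerD2l.
have -> : Ex (fun x => Ex (fun y => incr_energy X W 0 (x, y))) =
    Ex (var_incr X W) + Ex (fun x => Ex (fun y => max_incr W x y ^+ 2)).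
  rewrite -(Ex_D X bv (bdm_EE X (bdmX 2 bMX))).
  apply: eq_Ex => x.
  have bMx := bdmX 2 (bdm_pairl x bM).
  rewrite -[X in X + _](Ex_cst X) -(Ex_D X (bdm_cst _) bMx).
  by apply: eq_Ex => y; rewrite /incr_energy powRr0 mulr1.
have v1 : Ex (var_incr X W) <= alpha ^+ 2.
  have h : 1 <= q / 2 by rewrite ler_pdivlMr// mul1r.
  have := bE_lyapunov ltr01 h (ltW a20) (bdm_rv X bv)
    (fun _ => var_incr_ge0 _ _ _) hv.
  rewrite (powRr1 (ltW a20)); apply: le_trans; rewrite le_eqVlt.
  by apply/orP; left; apply/eqP; apply: eq_bE => w; rewrite powRr1 ?var_incr_ge0.
have M1 : Ex (fun x => Ex (fun y => max_incr W x y ^+ 2)) <= alpha ^+ 2 / 2.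
  pose M (p : Om * Om) := max_incr W (rv_tuple X p.1) (rv_tuple X p.2).
  have bMM : bdm M.
    have -> : M = (fun p => max_incr W p.1 p.2) \o
      (fun p : Om * Om => (rv_tuple X p.1, rv_tuple X p.2)) by [].
    apply: (bdm_comp _ bM); apply: measurable_fun_pair.
      exact: (measurableT_comp (measurable_rv_tuple X)).
    exact: (measurableT_comp (measurable_rv_tuple X)).
  have M0 p : 0 <= M p by exact: max_incr_ge0.
  have sq0 : 0 < alpha / Num.sqrt q by rewrite divr_gt0// sqrtr_gt0.
  have hMP : 'EE_(P \x P)%E (fun p => M p `^ q) <= (alpha / Num.sqrt q) `^ q.
    by rewrite bE_prod//; exact: (bdm_powR (ltW q0) M0 bMM).
  have two0 : 0 < 2 :> R by [].
  have := bE_lyapunov two0 q2 (ltW sq0) bMM M0 hMP.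
  rewrite bE_prod; last exact: (bdm_powR (ltW two0) M0 bMM).
  rewrite powR_mulrn ?(ltW sq0)// expr_div_n sqr_sqrtr ?(ltW q0)// => h.
  apply: (@le_trans _ _ (alpha ^+ 2 / q)); last first.
    by rewrite ler_wpM2l ?(ltW a20)// lef_pV2.
  apply: le_trans h; rewrite le_eqVlt; apply/orP; left; apply/eqP.
  apply: eq_bE => w; apply: eq_bE => w'.
  by rewrite powR_mulrn// M0.
apply: (le_trans (lerD v1 M1)).
by rewrite le_eqVlt; apply/orP; left; apply/eqP; field.
Qed.

Lemma second_moment_free (w : 'I_n -> n.-tuple E -> R) :
  (forall i, bdm (w i)) -> (forall i, coord_free i (w i)) ->
  (forall i x, eps <= w i x) ->
  (forall i, {ae P, forall z, W (rv_tuple X z) <= w i (rv_tuple X z)}) ->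
  Ex (fun x => (\sum_i (w i x - W x) ^+ 2) `^ (q / 2)) <=
    (alpha ^+ 2) `^ (q / 2) ->
  Ex (fun x => W x `^ 2) <= Ex W ^+ 2 + 3 / 2 * alpha ^+ 2.
Proof.
move=> bw wi epsw Ww hV.
have a20 : 0 < alpha ^+ 2 by rewrite exprn_gt0.
have := moment_recursion_free indX (lexx 1) bW eps0 epsW bw wi epsw Ww.
rewrite toP1 subrr -[1 + 1]/(2%:R) divff// mul1r => /le_trans; apply.
rewrite lerD2l.
have bV : bdm (fun x => \sum_i (w i x - W x) ^+ 2).
  by apply: bdm_sum => i; exact: bdmX (bdmB (bw i) bW).
have V0 (x : n.-tuple E) : 0 <= \sum_i (w i x - W x) ^+ 2.
  by apply: sumr_ge0 => i _; exact: sqr_ge0.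
have h : 1 <= q / 2 by rewrite ler_pdivlMr// mul1r.
have := bE_lyapunov ltr01 h (ltW a20) (bdm_rv X bV) (fun _ => V0 _) hV.
rewrite (powRr1 (ltW a20)) => hle.
apply: (@le_trans _ _ (alpha ^+ 2)); last first.
  by rewrite ler_peMl ?(ltW a20)// ler_pdivlMr// mul1r ler_nat.
apply: le_trans hle; rewrite le_eqVlt; apply/orP; left; apply/eqP.
by apply: eq_bE => z; rewrite powRr0 mulr1 powRr1.
Qed.

End second_moment.

(** * Truncation *)

Section truncations.
Context {R : realType}.
Implicit Types (a b k m z : R).

(** Nonincreasing and 1-Lipschitz, in one inequality. *)
Definition decr_contraction (theta : R -> R) :=
  forall a b, theta a - theta b <= Num.max (b - a) 0.

Definition clip k z := Num.max (- k) (Num.min z k).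
Definition cut k z := Num.min (Num.max (- z) 0) k.

Lemma clip_contraction m k c : decr_contraction (fun z => c - clip k (z - m)).
Proof.
move=> a b; rewrite /clip; case: (leP (b - a) 0); case: (leP (a - m) k);
  case: (leP (b - m) k); rewrite ?(maxEle (- k));
  case: (leP (- k) (a - m)); case: (leP (- k) (b - m)); case: (leP (- k) k); lra.
Qed.

Lemma cut_contraction m k c : 0 <= k ->
  decr_contraction (fun z => cut k (z - m) + c).
Proof.
move=> k0 a b; rewrite /cut; case: (leP (b - a) 0);
  case: (leP (- (a - m)) 0); case: (leP (- (b - m)) 0); rewrite ?(minEle _ k);
  case: (leP (- (a - m)) k); case: (leP (- (b - m)) k); case: (leP 0 k); lra.
Qed.

Lemma clip_le k z : 0 <= k -> - k <= clip k z <= k.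
Proof.
move=> k0; rewrite /clip; case: (leP z k); rewrite ?(maxEle (- k));
  case: (leP (- k) z); case: (leP (- k) k); lra.
Qed.

Lemma cut_ge0 k z : 0 <= k -> 0 <= cut k z.
Proof. by move=> k0; rewrite /cut le_min k0 le_max lexx orbT. Qed.

Lemma cut_le k z : cut k z <= k.
Proof. by rewrite /cut ge_min lexx orbT. Qed.

Lemma cut_sqr_le_clip k l z : 0 <= k -> k <= l -> cut k z ^+ 2 <= clip l z ^+ 2.
Proof.
move=> k0 kl; rewrite -[leRHS]real_normK ?num_real//.
rewrite lerXn2r ?nnegrE ?cut_ge0//; have [z0|z0] := leP 0 z.
  by rewrite /cut max_r ?oppr_le0// min_l.
apply: (@le_trans _ _ (- clip l z)); last by rewrite -normrN ler_norm.
rewrite /cut /clip max_l ?oppr_ge0 ?(ltW z0)// (min_l (_ : z <= l)); last lra.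
by case: (leP (- z) k); case: (leP (- l) z); lra.
Qed.

Lemma measurable_clip k : measurable_fun [set: R] (clip k).
Proof.
by apply: measurable_maxr => //; apply: measurable_minr.
Qed.

Lemma measurable_cut k : measurable_fun [set: R] (cut k).
Proof.
by apply: measurable_minr => //; apply: measurable_maxr.
Qed.

End truncations.

(** Here u and v stand for the first two moments of a clipped variable and c -
    u, c^2 - 2 c u + v for those of its reflection at c. *)
Lemma centered_second_moment {R : realType} (al c u v : R) : `|u| <= al / 4 ->
  c ^+ 2 - 2 * c * u + v <= (c - u) ^+ 2 + 3 / 2 * al ^+ 2 ->
  v <= 25 / 16 * al ^+ 2.
Proof.
rewrite ler_norml => /andP[h1 h2] h.
have : 0 <= (al / 4 - u) * (al / 4 + u) by apply: mulr_ge0; lra.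
lra.
Qed.

Section lower_tail.
Context {d d' : measure_display} {Om : measurableType d} {E : measurableType d'}.
Context {R : realType} {P : probability Om R} {n : nat}.
Variable X : 'I_n -> {RV P >-> E}.
Local Notation Ex := (@tuple_mean _ _ _ _ R P n X).
Variables (F : n.-tuple E -> R) (alpha q B : R).
Hypotheses (mF : measurable_fun [set: n.-tuple E] F).
Local Notation Z := (F \o rv_tuple X).
Hypotheses (iZ : P.-integrable [set: Om] (EFin \o Z)).
Hypotheses (al0 : 0 < alpha) (q2 : 2 <= q) (B0 : 0 < B).
Hypothesis core : forall (theta : R -> R) (eps k : R),
  measurable_fun [set: R] theta -> decr_contraction theta ->
  0 < eps -> (forall a, eps <= theta a) -> (forall a, theta a <= k) ->
  Ex (fun x => theta (F x) `^ 2) <=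
    Ex (fun x => theta (F x)) ^+ 2 + 3 / 2 * alpha ^+ 2 /\
  (Ex (fun x => theta (F x) `^ 2) <= (3 / 2 * alpha) `^ 2 ->
   Ex (fun x => theta (F x) `^ q) <= B `^ q).

Let mZ : measurable_fun [set: Om] Z.
Proof. exact: (measurableT_comp mF (measurable_rv_tuple X)). Qed.

Let mu := fine 'E_P[Z]%E.

Let EZ : ('E_P[Z] = mu%:E)%E.
Proof.
rewrite /mu fineK// unlock.
exact: (integrable_fin_num measurableT iZ).
Qed.

Let mclip k : measurable_fun [set: R] (fun z => clip k (z - mu)).
Proof.
apply: (measurableT_comp (measurable_clip k)).
by apply: measurable_funB => //; exact: measurable_cst.
Qed.

Let mcut k : measurable_fun [set: R] (fun z => cut k (z - mu)).
Proof.
apply: (measurableT_comp (measurable_cut k)).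
by apply: measurable_funB => //; exact: measurable_cst.
Qed.

Let bclip k : 0 <= k -> bdm (fun x => clip k (F x - mu)).
Proof.
move=> k0; apply: (bdm_bounded_comp (mclip k) mF (l := - k) (k := k)) => a.
  by have /andP[] := clip_le (a - mu) k0.
by have /andP[] := clip_le (a - mu) k0.
Qed.

Let bcut k : 0 <= k -> bdm (fun x => cut k (F x - mu)).
Proof.
move=> k0; apply: (bdm_bounded_comp (mcut k) mF (l := 0) (k := k)) => a.
  exact: cut_ge0.
exact: cut_le.
Qed.

Let clip_mean : (fun k : nat => Ex (fun x => clip k%:R (F x - mu))) @ \oo --> 0.
Proof.
pose f_ (k : nat) w := (clip k%:R (Z w - mu))%:E.
pose f w := (Z w - mu)%:E.
have if_ : P.-integrable [set: Om] f.
  have -> : f = (fun w => (EFin \o Z) w - (EFin \o cst mu) w)%E.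
    by apply/funext => w; rewrite /f EFinB.
  apply: integrableB => //.
  exact: (bdm_integrable P (bdm_cst mu)).
have mf_ k : measurable_fun [set: Om] (f_ k).
  by apply/measurable_EFinP; exact: (measurableT_comp (mclip k%:R) mZ).
have f0 : (\int[P]_w f w = 0)%E.
  rewrite (_ : f = (fun w => (EFin \o Z) w - (EFin \o cst mu) w)%E); last first.
    by apply/funext => w; rewrite /f EFinB.
  rewrite integralB//; last exact: (bdm_integrable P (bdm_cst mu)).
  have -> : (\int[P]_w (EFin \o Z) w = mu%:E)%E by rewrite -EZ unlock.
  rewrite (integral_bdm P (bdm_cst mu)) (bE_cst P mu) -EFinB subrr//.
have ff w : f_ ^~ w @ \oo --> f w.
  apply: cvg_near_cst; near=> k.
  rewrite /f_ /f /clip; congr EFin.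
  have : `|Z w - mu| <= k%:R.
    by near: k; exact: nbhs_infty_ger.
  by rewrite ler_norml => /andP[h1 h2]; rewrite min_l// max_r.
have : (\int[P]_w f_ k w)%E @[k --> \oo] --> (\int[P]_w f w)%E.
  have /integrableP[mf _] := if_.
  have ig : P.-integrable [set: Om] (fun w => `|f w|%E) by exact: integrable_abse.
  apply: (dominated_cvg measurableT mf_ (fun w _ => ff w) _ ig).
    by move=> w _; rewrite /f.
  move=> k w _; rewrite /f_ /f lee_fin /clip.
  have k0 : 0 <= k%:R :> R by [].
  rewrite ler_norml; have := ler_norm (Z w - mu); have := ler_norm (- (Z w - mu)).
  rewrite normrN; move: (Z w - mu) (k%:R) k0 => z l l0.
  move: (normr_ge0 z); move: (`|z|) => y.
  by case: (leP z l); rewrite ?maxEle; case: (leP (- l) z); case: (leP (- l) l);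
    lra.
rewrite f0 => /fine_cvgP[_]; apply: cvg_trans.
by apply: near_eq_cvg; near=> k.
Unshelve. all: by end_near. Qed.

Let cut_second_moment k : 0 <= k ->
  Ex (fun x => cut k (F x - mu) ^+ 2) <= 25 / 16 * alpha ^+ 2.
Proof.
move=> k0.
have a40 : 0 < alpha / 4 by rewrite divr_gt0.
have /cvgrPdist_le/(_ _ a40)[N _ HN] := clip_mean.
have [N2 kN2] : exists N2 : nat, k <= N2%:R.
  by exists (Num.Def.truncn k).+1; have /truncn_itv/andP[_ /ltW] := k0.
pose K := maxn N N2.
have kK : k <= K%:R by rewrite (le_trans kN2)// ler_nat leq_maxr.
have K0 : 0 <= K%:R :> R by [].
have := HN K (leq_maxl _ _); rewrite /= sub0r normrN => mean.
have bG := bclip K0.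
apply: (@le_trans _ _ (Ex (fun x => clip K%:R (F x - mu) ^+ 2))).
  by apply: (Ex_le X (bdmX 2 (bcut k0)) (bdmX 2 bG)) => x; exact: cut_sqr_le_clip.
(* K + 1 minus the clipped variable is decreasing in Z and at least 1 *)
pose c : R := K%:R + 1.
have mt : measurable_fun [set: R] (fun z => c - clip K%:R (z - mu)).
  by apply: measurable_funB => //; exact: measurable_cst.
have [||] := core mt (clip_contraction mu K%:R c) ltr01 (k := 2 * K%:R + 1).
- by move=> a; have := clip_le (a - mu) K0; rewrite /c; lra.
- by move=> a; have := clip_le (a - mu) K0; rewrite /c; lra.
move=> var _; move: var.
have bc := bdm_cst (T := n.-tuple E) c.
have -> : Ex (fun x => c - clip K%:R (F x - mu)) =
    c - Ex (fun x => clip K%:R (F x - mu)).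
  by rewrite (Ex_B X bc bG) Ex_cst.
have -> : Ex (fun x => (c - clip K%:R (F x - mu)) `^ 2) =
    c ^+ 2 - 2 * c * Ex (fun x => clip K%:R (F x - mu)) +
    Ex (fun x => clip K%:R (F x - mu) ^+ 2).
  rewrite -(Ex_Z X _ bG) -[c ^+ 2](Ex_cst X) -(Ex_B X (bdm_cst _) (bdmZ _ bG)).
  rewrite -(Ex_D X (bdmB (bdm_cst _) (bdmZ _ bG)) (bdmX 2 bG)).
  apply: eq_Ex => x; rewrite powR_mulrn; first by ring.
  by have := clip_le (F x - mu) K0; rewrite /c; lra.
exact: centered_second_moment mean.
Qed.

Let truncated_moment (k : nat) :
  Ex (fun x => cut k%:R (F x - mu) `^ q) <= B `^ q.
Proof.
have k0 : 0 <= k%:R :> R by [].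
have q0 : 0 <= q by apply: le_trans q2.
have a40 : 0 < alpha / 4 by rewrite divr_gt0.
have a54 : 0 < 5 / 4 * alpha by rewrite mulr_gt0// divr_gt0.
have bC := bcut k0.
have C0 x : 0 <= cut k%:R (F x - mu) by exact: cut_ge0.
have ba := bdm_cst (T := n.-tuple E) (alpha / 4).
have mt : measurable_fun [set: R] (fun z => cut k%:R (z - mu) + alpha / 4).
  by apply: measurable_funD => //; exact: measurable_cst.
have [||_] := core mt (cut_contraction mu (alpha / 4) k0) a40
    (k := k%:R + alpha / 4).
- by move=> a; rewrite lerDr cut_ge0.
- by move=> a; rewrite lerD2r cut_le.
move=> h.
have bCa := bdmD bC ba.
have Ca0 x : 0 <= cut k%:R (F x - mu) + alpha / 4.
  by rewrite addr_ge0// ltW.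
apply: (@le_trans _ _ (Ex (fun x => (cut k%:R (F x - mu) + alpha / 4) `^ q))).
  apply: (Ex_le X (bdm_powR q0 C0 bC) (bdm_powR q0 Ca0 bCa)) => x.
  by apply: le_powR => //; rewrite lerDl ltW.
apply: h.
have -> : 3 / 2 * alpha = 5 / 4 * alpha + alpha / 4 by lra.
have t12 : 1 <= 2 :> R by rewrite ler1n.
apply: (bE_minkowski t12 (bdm_rv X bC) (bdm_rv X ba) _ _ a54 a40) => //.
- by move=> w; exact: ltW.
- rewrite powR_mulrn ?(ltW a54)// exprMn expr_div_n.
  have -> : 5 ^+ 2 / 4 ^+ 2 = 25 / 16 :> R by lra.
  apply: le_trans (cut_second_moment k0); rewrite le_eqVlt; apply/orP; left.
  by apply/eqP; apply: eq_bE => w; rewrite powR_mulrn.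
- by rewrite bE_cst.
Qed.

(** Reduction to bounded functions theta(F). The first half of the hypothesis
    core, for Z - E Z clipped at a level so high that its mean is at most alpha
    / 4 in absolute value, bounds the second moment of the truncations of (Z -
    E Z)_- by (5/4 alpha)^2. Adding alpha / 4 to a truncation makes it positive
    and keeps its norm below 3/2 alpha, which is what the second half of core
    requires. *)
Theorem lower_tail_Lnorm :
  ('N[P]_(q%:E)[(fun w => (Z w)%:E - 'E_P[Z])^\-] <= B%:E)%E.
Proof.
have q0 : 0 < q by apply: lt_le_trans q2.
have qn0 : q != 0 by rewrite gt_eqF.
rewrite EZ unlock.
have -> : B%:E = ((B `^ q)%:E `^ q^-1)%E.
  by rewrite poweR_EFin -powRrM mulfV// powRr1// ltW.
apply: gt0_ler_poweR.
- by rewrite invr_ge0 ltW.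
- by rewrite in_itv/= leey andbT; apply: integral_ge0 => w _; exact: poweR_ge0.
- by rewrite in_itv/= leey andbT lee_fin powR_ge0.
pose g (k : nat) w := (cut k%:R (Z w - mu) `^ q)%:E.
have C0 (k : nat) z : 0 <= cut (k%:R : R) z by exact: cut_ge0.
have mg k : measurable_fun [set: Om] (g k).
  apply/measurable_EFinP; apply: (measurableT_comp (measurable_powR q)).
  exact: (measurableT_comp (mcut k%:R) mZ).
have g0 k w : [set: Om] w -> (0 <= g k w)%E by rewrite lee_fin powR_ge0.
have nd w : [set: Om] w -> nondecreasing_seq (g^~ w).
  move=> _ k l kl; rewrite lee_fin; apply: le_powR => //; first exact: ltW.
  by rewrite /cut le_min ge_min lexx/= ge_min ler_nat kl orbT.
have cvg := cvg_monotone_convergence measurableT mg g0 nd.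
have lim w : limn (g^~ w) =
    (`|((fun w => (Z w)%:E - mu%:E)^\-)%E w| `^ q)%E.
  apply/cvg_lim => //; apply: cvg_near_cst; near=> k.
  rewrite /g funenegE -EFinB -EFinN -EFin_max abse_EFin poweR_EFin.
  congr (_ `^ _)%:E; rewrite ger0_norm ?le_max ?lexx ?orbT//.
  rewrite /cut min_l// ge_max; apply/andP; split => //.
  apply: (@le_trans _ _ `|Z w - mu|); first by rewrite -normrN ler_norm.
  by near: k; exact: nbhs_infty_ger.
under eq_integral do rewrite -lim.
apply: (cvge_to_le (cvg P)); apply: nearW => k.
have bC := bcut (ler0n R k).
rewrite (integral_bdm P (bdm_rv X (bdm_powR (ltW q0) (fun x => C0 k _) bC))).
by rewrite lee_fin; exact: truncated_moment.
Unshelve. all: by end_near. Qed.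

End lower_tail.

(** * Comparison of integrals and conditional expectations *)

Section integral_comparison.
Context {d : measure_display} {T : measurableType d} {R : realType}.
Variable P : probability T R.
Local Open Scope ereal_scope.

Lemma le_integral_pointwise (D : set T) (f g : T -> \bar R) : measurable D ->
  measurable_fun D f -> measurable_fun D g ->
  (forall x, D x -> f x <= g x) ->
  \int[P]_(x in D) f x <= \int[P]_(x in D) g x.
Proof.
move=> mD mf mg fg; rewrite integralE [leRHS]integralE; apply: leeB.
- apply: ge0_le_integral => //.
  + exact: measurable_funepos.
  + exact: measurable_funepos.
  + by move=> x Dx; rewrite !funeposE ge_max !le_max fg// lexx orbT.
- apply: ge0_le_integral => //.
  + exact: measurable_funeneg.
  + exact: measurable_funeneg.
  + by move=> x Dx; rewrite !funenegE ge_max !le_max leeN2 fg// lexx orbT.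
Qed.

Lemma bE_le_Lnorm (f : T -> R) (G : T -> \bar R) (t c : R) :
  (0 < t)%R -> (0 <= c)%R -> bdm f -> (forall x, 0 <= f x)%R ->
  measurable_fun [set: T] G -> {ae P, forall x, (f x)%:E <= `|G x|} ->
  'N[P]_(t%:E)[G] <= c%:E -> ('EE_P (fun x => f x `^ t)%R <= c `^ t)%R.
Proof.
move=> t0 c0 bf f0 mG fG NG.
have bft := bdm_powR (ltW t0) f0 bf.
rewrite -lee_fin -(integral_bdm P bft).
apply: (@le_trans _ _ (\int[P]_x (`|G x| `^ t))).
  apply: ae_ge0_le_integral => //.
  - by move=> x _; rewrite lee_fin powR_ge0.
  - by apply/measurable_EFinP; case: bft.
  - by move=> x _; exact: poweR_ge0.
  - apply: (measurableT_comp (measurable_poweR t)).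
    exact: measurableT_comp.
  apply: filterS fG => x fG _; rewrite -poweR_EFin.
  apply: gt0_ler_poweR => //; rewrite ?in_itv/= ?leey ?andbT ?lee_fin//.
  exact: ltW.
have <- : 'N[P]_(t%:E)[G] `^ t = \int[P]_x (`|G x| `^ t).
  by rewrite poweR_Lnorm// gt_eqF.
rewrite -poweR_EFin; apply: gt0_ler_poweR => //; first exact: ltW.
- by rewrite in_itv/= leey andbT Lnorm_ge0.
- by rewrite in_itv/= leey andbT lee_fin.
Qed.

End integral_comparison.

Section conditional_expectation.
Context {d d' : measure_display} {T : measurableType d} {T' : measurableType d'}.
Context {R : realType} {P : probability T R}.
Variable Y : T -> T'.
Hypothesis mY : measurable_fun [set: T] Y.
Local Open Scope ereal_scope.

Lemma measurable_cond_expectation (U W : T -> \bar R) :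
  is_cond_expectation P Y U W -> measurable_fun [set: T] W.
Proof.
move=> [mW _] _ B mB; have [C mC <-] := mW measurableT B mB.
exact: mY.
Qed.

(** The event W < v(Y) - 1/(m+1) belongs to the sigma-algebra of Y, and
    integration over it shows that it is negligible for every m. *)
Lemma cond_expectation_ge (U W : T -> \bar R) (v : T' -> R) : bdm v ->
  is_cond_expectation P Y U W ->
  (forall B, measurable B ->
     \int[P]_(w in Y @^-1` B) (v (Y w))%:E <= \int[P]_(w in Y @^-1` B) U w) ->
  {ae P, forall w, (v (Y w))%:E <= W w}.
Proof.
move=> bv ceW vU; have mWT := measurable_cond_expectation ceW.
have [mW WU] := ceW.
have bvY := bdm_comp mY bv.
suff H (m : nat) : {ae P, forall w, (v (Y w))%:E - m.+1%:R^-1%:E <= W w}.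
  have := ae_foralln H.
  apply: filterS => w h; apply/lee_subgt0Pr => e e0.
  pose m := Num.Def.truncn e^-1.
  apply: le_trans (h m); rewrite leeD2l// leeN2 lee_fin.
  have /truncn_itv/andP[_ /ltW me] : (0 <= e^-1)%R by rewrite invr_ge0 ltW.
  by rewrite -[leRHS]invrK lef_pV2 ?posrE ?invr_gt0.
pose c : R := (m.+1%:R^-1)%R.
have c0 : (0 < c)%R by rewrite invr_gt0.
pose g w := (v (Y w) - c)%:E.
pose D := [set w | W w < g w].
have mgY : measurable_fun [set: g_sigma_algebra_preimageType Y]
    (g : g_sigma_algebra_preimageType Y -> \bar R).
  apply/measurable_EFinP => /= _ B mB.
  have mvc : measurable_fun [set: T'] (fun y => v y - c)%R.
    by apply: measurable_funB => //; case: bv.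
  exists ((fun y => v y - c)%R @^-1` B); last by rewrite !setTI.
  by have := mvc measurableT B mB; rewrite setTI.
have [B mB DB] : g_sigma_algebra_preimage Y D.
  have := measurable_lte measurableT mW mgY.
  by rewrite setTI.
rewrite setTI in DB.
have mD : measurable D.
  by rewrite -DB; have := mY measurableT mB; rewrite setTI.
have bg : bdm (fun w => v (Y w) - c)%R by apply: bdmB => //; exact: bdm_cst.
have mg : measurable_fun [set: T] g by apply/measurable_EFinP; case: bg.
have iv : P.-integrable D (fun w => (v (Y w))%:E).
  exact: (integrableS measurableT mD (@subsetT _ _) (bdm_integrable P bvY)).
have ic : P.-integrable D (fun w => c%:E).
  exact: (integrableS measurableT mD (@subsetT _ _) (bdm_integrable P (bdm_cst c))).
have PD0 : P D = 0.
  have h1 : \int[P]_(w in D) (v (Y w))%:E <= \int[P]_(w in D) g w.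
    apply: (@le_trans _ _ (\int[P]_(w in D) U w)).
      by have := vU B mB; rewrite DB.
    rewrite -WU; last by exists B => //; rewrite setTI.
    apply: le_integral_pointwise => //.
    - exact: measurable_funTS.
    - exact: measurable_funTS.
    - by move=> w /ltW.
  move: h1; rewrite [leRHS](_ : _ = \int[P]_(w in D) ((v (Y w))%:E - c%:E))//.
  rewrite integralB// integral_cst//.
  have fv := integrable_fin_num mD iv.
  rewrite -[leLHS]adde0 leeD2lE// oppe_ge0 => h.
  apply/eqP; rewrite eq_le measure_ge0 andbT.
  by move: h; rewrite pmule_rle0.
exists D; split => // w /= nle; rewrite /D/= /g EFinB ltNge.
by apply/negP => le; exact: nle.
Qed.

End conditional_expectation.

(** * Resampling and deletion *)

Lemma integral_indic_bdm {d : measure_display} {T : measurableType d}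
    {R : realType} (P : probability T R) (D : set T) (f : T -> R) :
  measurable D -> bdm f ->
  (\int[P]_(w in D) (f w)%:E)%E = ('EE_P (fun w => \1_D w * f w))%:E.
Proof.
move=> mD bf; have b1 := bdm_indic (R := R) mD.
rewrite -(integral_bdm P (bdmM b1 bf)) integral_mkcond.
apply: eq_integral => w _; rewrite patchE indicE.
by case: ifP => _; rewrite ?mul1r ?mul0r.
Qed.

(** Both the pair and two independent draws of Y have the product of the law of
    Y with itself as their law. *)
Lemma bE_copy {d d' : measure_display} {Om : measurableType d}
    {T : measurableType d'} {R : realType} (P : probability Om R)
    (Y Y' : Om -> T) (G : T * T -> R) :
  measurable_fun [set: Om] Y -> measurable_fun [set: Om] Y' ->
  independent_copy P Y Y' -> bdm G ->
  'EE_P (fun w => G (Y w, Y' w)) =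
  'EE_P (fun w => 'EE_P (fun w' => G (Y w, Y w'))).
Proof.
move=> mY mY' [ind same] bG; rewrite (bE_indep mY mY' bG ind).
apply: eq_bE => w.
pose H : {mfun Om >-> T} := HB.pack Y (isMeasurableFun.Build _ _ _ _ _ mY).
have bGw := bdm_pairl (Y w) bG.
rewrite -(@bE_law _ _ _ _ _ P (distribution P H) Y' _ mY' bGw); last first.
  by move=> A mA; rewrite same.
exact: (@bE_law _ _ _ _ _ P (distribution P H) Y _ mY bGw).
Qed.

Lemma upd_replace_coord {Om E : Type} {n : nat} (X X' : 'I_n -> Om -> E) i w :
  upd (rv_tuple X w) i (X' i w) = replace_coord X X' i w.
Proof.
apply: eq_from_tnth => j; rewrite tnth_upd !tnth_mktuple.
by case: eqP => // ->.
Qed.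

Section cores.
Context {d d' : measure_display} {Om : measurableType d} {E : measurableType d'}.
Context {R : realType} {P : probability Om R} {n : nat}.
Variable X : 'I_n -> {RV P >-> E}.
Hypothesis indX : mutually_independent P X.
Local Notation Ex := (@tuple_mean _ _ _ _ R P n X).
Variables (F : n.-tuple E -> R) (alpha q : R).
Hypotheses (mF : measurable_fun [set: n.-tuple E] F).
Local Notation Z := (F \o rv_tuple X).
Hypotheses (iZ : P.-integrable [set: Om] (EFin \o Z)).
Hypotheses (al0 : 0 < alpha) (q2 : 2 <= q).
Variable M : {RV P >-> R}.
Hypothesis NM : ('N[P]_(q%:E)[EFin \o M] <= (alpha / Num.sqrt q)%:E)%E.

Let q0 : 0 < q. Proof. exact: lt_le_trans q2. Qed.
Let q20 : 0 < q / 2. Proof. by rewrite divr_gt0. Qed.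
Let a20 : 0 < alpha ^+ 2. Proof. by rewrite exprn_gt0. Qed.
Let sq0 : 0 < alpha / Num.sqrt q. Proof. by rewrite divr_gt0// sqrtr_gt0. Qed.
Let mM : measurable_fun [set: Om] (EFin \o M).
Proof. by apply/measurable_EFinP. Qed.

Section increments.
Variables (X' : 'I_n -> {RV P >-> E}) (Vplus : Om -> \bar R).
Local Notation Z' i := (F \o replace_coord X X' i).
Hypothesis copyX : independent_copy P (rv_tuple X) (rv_tuple X').
Hypothesis ceV : is_cond_expectation P (rv_tuple X)
  (fun w => (\sum_(i < n) (Num.max (Z w - Z' i w) 0) ^+ 2)%R%:E) Vplus.
Hypothesis M0 : {ae P, forall w, 0 < M w}.
Hypothesis ZM : forall i, {ae P, forall w, Num.max (Z w - Z' i w) 0 <= M w}.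
Hypothesis NV : ('N[P]_((q / 2)%:E)[Vplus] <= (alpha ^+ 2)%:E)%E.

Let updX i w : upd (rv_tuple X w) i (X' i w) = replace_coord X X' i w.
Proof. exact: (upd_replace_coord X X'). Qed.

Let mX := measurable_rv_tuple X.
Let mX' := measurable_rv_tuple X'.

Lemma incr_comp_le (theta : R -> R) x i y : decr_contraction theta ->
  incr (theta \o F) x i y <= Num.max (F x - F (upd x i y)) 0.
Proof. by move=> dt; rewrite /incr ge_max dt le_max lexx orbT. Qed.

(** The increments of theta(F) are dominated by those of F. The maximum of the
    increments is compared with M on the original space, where X' lives, and
    moved to the product space by bE_copy, which allows M to depend on X' in
    any way. *)
Lemma incr_bounds (theta : R -> R) (eps k : R) :
  measurable_fun [set: R] theta -> decr_contraction theta ->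
  0 < eps -> (forall a, eps <= theta a) -> (forall a, theta a <= k) ->
  Ex (fun x => var_incr X (theta \o F) x `^ (q / 2)) <= (alpha ^+ 2) `^ (q / 2)
  /\ Ex (fun x => Ex (fun y => max_incr (theta \o F) x y `^ q)) <=
     (alpha / Num.sqrt q) `^ q.
Proof.
move=> mt dt eps0 et tk.
have bW := bdm_bounded_comp mt mF et tk; rewrite -/(theta \o F) in bW.
set W := theta \o F in bW *.
have copyE (G : n.-tuple E * n.-tuple E -> R) : bdm G ->
    'EE_P (fun w => G (rv_tuple X w, rv_tuple X' w)) =
    Ex (fun x => Ex (fun y => G (x, y))).
  by move=> bG; exact: bE_copy.
have mXX : measurable_fun [set: Om] (fun w => (rv_tuple X w, rv_tuple X' w)).
  exact: measurable_fun_pair.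
have incrX i w : incr W (rv_tuple X w) i (X' i w) <= Num.max (Z w - Z' i w) 0.
  by apply: (le_trans (incr_comp_le _ _ _ dt)); rewrite updX.
split; last first.
  have bM := bdm_max_incr bW.
  have bMq := bdm_powR (ltW q0) (fun p => max_incr_ge0 W p.1 p.2) bM.
  rewrite -(copyE _ bMq).
  have bMX := bdm_comp mXX bM.
  apply: (bE_le_Lnorm q0 (ltW sq0) bMX (fun w => max_incr_ge0 _ _ _) mM _ NM).
  have ZMa := filter_forall (ae_filter_ringOfSetsType P) ZM.
  apply: filterS2 M0 ZMa => w Mw0 ZMw; rewrite lee_fin.
  apply: (@le_trans _ _ (M w)); last exact: ler_norm.
  apply: bigmax_le => [|i _]; first exact: ltW.
  by apply: le_trans (ZMw i); rewrite tnth_mktuple; exact: incrX.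
have bv := bdm_var_incr X bW.
have v0 x : 0 <= var_incr X W x by exact: var_incr_ge0.
apply: (bE_le_Lnorm q20 (ltW a20) (bdm_rv X bv) (fun w => v0 _)
  (measurable_cond_expectation mX ceV) _ NV).
suff : {ae P, forall w, ((var_incr X W (rv_tuple X w))%:E <= Vplus w)%E}.
  by apply: filterS => w /le_trans; apply; exact: lee_abs.
apply: (cond_expectation_ge mX bv ceV) => B mB.
have mXB : measurable (rv_tuple X @^-1` B).
  by have := mX measurableT mB; rewrite setTI.
rewrite (integral_indic_bdm P mXB (bdm_rv X bv)).
pose S (p : n.-tuple E * n.-tuple E) : R :=
  \sum_i incr W p.1 i (tnth p.2 i) ^+ 2.
have bI i : bdm (fun p : n.-tuple E * n.-tuple E => incr W p.1 i (tnth p.2 i)).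
  have mp : measurable_fun [set: n.-tuple E * n.-tuple E]
      (fun p => (p.1, tnth p.2 i)).
    apply: measurable_fun_pair => //.
    exact: (measurableT_comp (measurable_tnth i)).
  exact: (bdm_comp mp (bdm_incr bW i)).
have bS : bdm S by apply: bdm_sum => i; exact: bdmX.
have b1 := bdm_indic (R := R) mB.
have b1S : bdm (fun p => \1_B p.1 * S p).
  by apply: bdmM => //; exact: (bdm_comp _ b1).
have -> : 'EE_P (fun w => \1_(rv_tuple X @^-1` B) w *
      var_incr X W (rv_tuple X w)) =
    'EE_P (fun w => \1_(rv_tuple X @^-1` B) w *
      S (rv_tuple X w, rv_tuple X' w)).
  transitivity (Ex (fun x => Ex (fun y => \1_B x * S (x, y)))).
    apply: eq_bE => w; set x := rv_tuple X w.
    rewrite (Ex_Z X _ (bdm_pairl x bS)); congr (_ * _).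
    rewrite /S/= (Ex_sum X _ (fun i => bdmX 2 (bdm_pairl x (bI i)))).
    apply: eq_bigr => i _; apply: eq_bE => w'.
    by rewrite tnth_mktuple.
  by rewrite -(copyE _ b1S).
rewrite -(integral_indic_bdm P mXB (bdm_comp mXX bS)).
apply: ge0_le_integral => //.
- by move=> w _; rewrite lee_fin; apply: sumr_ge0 => i _; exact: sqr_ge0.
- by apply: measurable_funTS; apply/measurable_EFinP; case: (bdm_comp mXX bS).
- apply: measurable_funTS; apply/measurable_EFinP.
  apply: measurable_sum => i; apply: measurable_funX.
  apply: measurable_maxr => //; apply: measurable_funB.
    exact: (measurableT_comp mF).
  apply: (measurableT_comp mF).
  apply: (eq_measurable_fun (fun w => upd (rv_tuple X w) i (X' i w))).
    by move=> w _; exact: updX.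
  have -> : (fun w => upd (rv_tuple X w) i (X' i w)) =
    (fun p : n.-tuple E * E => upd p.1 i p.2) \o
    (fun w => (rv_tuple X w, X' i w)) by [].
  apply: (measurableT_comp (measurable_upd i)).
  exact: measurable_fun_pair.
- move=> w _; rewrite lee_fin; apply: ler_sum => i _.
  apply: lerXn2r; rewrite ?nnegrE ?incr_ge0//= ?le_max ?lexx ?orbT//.
  by rewrite tnth_mktuple -le_max; exact: incrX.
Qed.

(** The bound with a number alpha in place of the square root of the maximum;
    the truncations theta of lower_tail_Lnorm reduce it to bounded functions.
    *)
Lemma lower_tail_incr :
  ('N[P]_(q%:E)[(fun w => (Z w)%:E - 'E_P[Z])^\-] <=
   (53 / 26 * alpha * Num.sqrt q)%:E)%E.
Proof.
have B0 : 0 < 53 / 26 * alpha * Num.sqrt q by rewrite !mulr_gt0 ?sqrtr_gt0.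
apply: (lower_tail_Lnorm mF iZ al0 q2 B0) => theta eps k mt dt eps0 et tk.
have bW := bdm_bounded_comp mt mF et tk; rewrite -/(theta \o F) in bW.
have [hv hM] := incr_bounds mt dt eps0 et tk.
have eW x : eps <= (theta \o F) x by exact: et.
split; first exact: (second_moment_incr indX bW eps0 eW al0 q2 hv hM).
by move=> h; exact: (moment_bound_incr indX bW eps0 eW al0 q2 h hv hM).
Qed.

End increments.

Section deletions.
Variable Fdel : 'I_n -> n.-1.-tuple E -> R.
Hypothesis mFdel : forall i, measurable_fun [set: n.-1.-tuple E] (Fdel i).
Local Notation Zdel i := (Fdel i \o delete_coord X i).
Local Notation V := (fun w => (\sum_(i < n) (Z w - Zdel i w) ^+ 2)%R).
Hypothesis M0 : {ae P, forall w, 0 < M w}.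
Hypothesis ZM : forall i, {ae P, forall w, 0 <= Z w - Zdel i w <= M w}.
Hypothesis NV : ('N[P]_((q / 2)%:E)[EFin \o V] <= (alpha ^+ 2)%:E)%E.

Definition del_coord (i : 'I_n) (x : n.-tuple E) : n.-1.-tuple E :=
  [tuple tnth x (lift i j) | j < n.-1].

Lemma measurable_del_coord i : measurable_fun [set: n.-tuple E] (del_coord i).
Proof.
apply/measurable_fun_tnthP => j.
apply: (eq_measurable_fun (fun x : n.-tuple E => tnth x (lift i j))).
  by move=> x _ /=; rewrite tnth_mktuple.
exact: measurable_tnth.
Qed.

Lemma del_coord_rv i w : del_coord i (rv_tuple X w) = delete_coord X i w.
Proof. by apply: eq_from_tnth => j; rewrite !tnth_mktuple. Qed.

Lemma del_coord_free i : coord_free i (del_coord i).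
Proof.
move=> x y; apply: eq_from_tnth => j; rewrite !tnth_mktuple.
by rewrite eq_sym (negbTE (neq_lift i j)).
Qed.

(** Here theta(Z_i) is the constant of the variational formula: it does not
    change with X_i, and theta(Z_i) - theta(Z) lies between 0 and Z - Z_i. *)
Lemma lower_tail_free :
  ('N[P]_(q%:E)[(fun w => (Z w)%:E - 'E_P[Z])^\-] <=
   (14 / 9 * alpha * Num.sqrt q)%:E)%E.
Proof.
have B0 : 0 < 14 / 9 * alpha * Num.sqrt q by rewrite !mulr_gt0 ?sqrtr_gt0.
apply: (lower_tail_Lnorm mF iZ al0 q2 B0) => theta eps k mt dt eps0 et tk.
have bW := bdm_bounded_comp mt mF et tk.
pose W x := theta (F x); rewrite -/W in bW.
pose w i x := theta (Fdel i (del_coord i x)).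
have bw i : bdm (w i).
  have mfi := measurableT_comp (mFdel i) (measurable_del_coord i).
  exact: (bdm_bounded_comp mt mfi et tk).
have wfree i : coord_free i (w i).
  by move=> x y; rewrite /w del_coord_free.
have ew i x : eps <= w i x by exact: et.
have eW x : eps <= W x by exact: et.
have ZMa := filter_forall (ae_filter_ringOfSetsType P) ZM.
have wW i z : Zdel i z <= Z z -> W (rv_tuple X z) <= w i (rv_tuple X z).
  move=> ZZ; rewrite -subr_le0 /W /w del_coord_rv.
  by apply: (le_trans (dt _ _)); rewrite max_r// subr_le0.
have wWZ i z : Zdel i z <= Z z ->
    w i (rv_tuple X z) - W (rv_tuple X z) <= Z z - Zdel i z.
  move=> ZZ; rewrite /W /w del_coord_rv.
  by apply: (le_trans (dt _ _)); rewrite max_l// subr_ge0.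
have Ww i : {ae P, forall z, W (rv_tuple X z) <= w i (rv_tuple X z)}.
  by apply: filterS (ZM i) => z /andP[h _]; apply: wW; rewrite -subr_ge0.
have bD i := bdmB (bw i) bW.
have bV : bdm (fun x => \sum_i (w i x - W x) ^+ 2).
  by apply: bdm_sum => i; exact: bdmX.
have bMm : bdm (fun x => \big[Num.max/0]_i (w i x - W x)).
  by apply: bdm_bigmax.
have V0 (x : n.-tuple E) : 0 <= \sum_i (w i x - W x) ^+ 2.
  by apply: sumr_ge0 => i _; exact: sqr_ge0.
have Mm0 x : 0 <= \big[Num.max/0]_i (w i x - W x) by exact: bigmax_ge_id.
have mV : measurable_fun [set: Om] (EFin \o V).
  apply/measurable_EFinP; apply: measurable_sum => i; apply: measurable_funX.
  apply: measurable_funB.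
    exact: (measurableT_comp mF (measurable_rv_tuple X)).
  apply: (measurableT_comp (mFdel i)).
  apply: (eq_measurable_fun (fun z => del_coord i (rv_tuple X z))).
    by move=> z _; exact: del_coord_rv.
  exact: (measurableT_comp (measurable_del_coord i) (measurable_rv_tuple X)).
have hV : Ex (fun x => (\sum_i (w i x - W x) ^+ 2) `^ (q / 2)) <=
    (alpha ^+ 2) `^ (q / 2).
  apply: (bE_le_Lnorm q20 (ltW a20) (bdm_rv X bV) (fun _ => V0 _) mV _ NV).
  apply: filterS ZMa => z h; rewrite lee_fin.
  apply: le_trans (ler_norm _); apply: ler_sum => i _.
  have /andP[h1 _] := h i; have ZZ : Zdel i z <= Z z by rewrite -subr_ge0.
  rewrite lerXn2r ?nnegrE ?h1 ?wWZ// subr_ge0; exact: wW.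
have hM : Ex (fun x => (\big[Num.max/0]_i (w i x - W x)) `^ q) <=
    (alpha / Num.sqrt q) `^ q.
  apply: (bE_le_Lnorm q0 (ltW sq0) (bdm_rv X bMm) (fun _ => Mm0 _) mM _ NM).
  apply: filterS2 M0 ZMa => z Mz0 h; rewrite lee_fin.
  apply: le_trans (ler_norm _); apply: bigmax_le => [|i _]; first exact: ltW.
  have /andP[h1 h2] := h i; apply: le_trans h2; apply: wWZ.
  by rewrite -subr_ge0.
split; first exact: (second_moment_free indX bW eps0 eW al0 q2 bw wfree ew Ww hV).
move=> h2.
exact: (moment_bound_free indX bW eps0 eW al0 q2 h2 bw wfree ew Ww hV hM).
Qed.

End deletions.

End cores.

(** * The moment inequalities *)

Local Open Scope ereal_scope.

Lemma Lnorm_gt0 {d : measure_display} {T : measurableType d} {R : realType}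
    (P : probability T R) (M : {RV P >-> R}) (q : R) : (0 < q)%R ->
  {ae P, forall w, (0 < M w)%R} -> 0 < 'N[P]_(q%:E)[EFin \o M].
Proof.
move=> q0 M0; rewrite lt_neqAle Lnorm_ge0 andbT eq_sym; apply/negP => /eqP N0.
have mM : measurable_fun [set: T] (EFin \o M) by apply/measurable_EFinP.
have q0e : 0 < q%:E by rewrite lte_fin.
have := Lnorm_eq0_eq0 mM q0e N0 => M00.
have : {ae P, forall w, False}.
  by apply: filterS2 M0 M00 => w /[swap] /(_ I)[->]; rewrite ltxx.
move=> [N [mN PN0]] /= sub.
have : P [set: T] <= P N.
  by apply: le_measure; rewrite ?inE// => w _; apply: sub => -[].
by rewrite probability_setT PN0 lee_fin ler10.
Qed.

(** The best alpha is the square root of the maximum. This maximum is positive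
    because N2 is, and if it is infinite there is nothing to prove. *)
Lemma scale_to_moments {R : realType} (kappa q : R) (N1 N2 L : \bar R) :
  (0 < kappa)%R -> (0 < q)%R -> 0 <= N1 -> 0 < N2 ->
  (forall alpha : R, (0 < alpha)%R -> N1 <= (alpha ^+ 2)%:E ->
    N2 <= (alpha / Num.sqrt q)%:E -> L <= (kappa * alpha * Num.sqrt q)%:E) ->
  L <= ((kappa ^+ 2 * q)%:E * maxe N1 (q%:E * N2 ^+ 2)) `^ (2^-1)%R.
Proof.
move=> k0 q0 N10 N20 H; set A := maxe _ _.
have kq0 : (0 < kappa ^+ 2 * q)%R by rewrite mulr_gt0// exprn_gt0.
have sq0 : (0 < Num.sqrt q)%R by rewrite sqrtr_gt0.
have A1 : N1 <= A by rewrite le_max lexx.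
have A2 : q%:E * N2 ^+ 2 <= A by rewrite le_max lexx orbT.
case EA : A => [a| |]; rewrite EA in A1 A2.
- have N2f : N2 \is a fin_num.
    rewrite gt0_fin_numE// ltey; apply/eqP => N2y; move: A2.
    by rewrite N2y expe2 mulyy gt0_muley ?lte_fin.
  move: N20 A2 H; rewrite -(fineK N2f); set r := fine N2.
  rewrite lte_fin -EFin_expe -EFinM lee_fin => r0 ra H.
  have a0 : (0 < a)%R.
    by apply: lt_le_trans ra; rewrite mulr_gt0// exprn_gt0.
  have sa0 : (0 < Num.sqrt a)%R by rewrite sqrtr_gt0.
  have sqa : (Num.sqrt a ^+ 2 = a)%R by rewrite sqr_sqrtr// ltW.
  have := H _ sa0; rewrite sqa => /(_ A1).
  have ra2 : (r <= Num.sqrt a / Num.sqrt q)%R.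
    rewrite ler_pdivlMr// -[leLHS]ger0_norm; last by rewrite mulr_ge0// ltW.
    by rewrite -sqrtr_sqr ler_wsqrtr// exprMn sqr_sqrtr ?(ltW q0)// mulrC.
  rewrite lee_fin => /(_ ra2) /le_trans; apply.
  rewrite -EFinM poweR_EFin lee_fin powR12_sqrt; last first.
    by rewrite mulr_ge0 ?ltW.
  have e : (kappa ^+ 2 * q * a = (kappa * Num.sqrt a * Num.sqrt q) ^+ 2)%R.
    by rewrite !exprMn sqa sqr_sqrtr ?(ltW q0)// mulrAC.
  by rewrite e sqrtr_sqr ler_norm.
- by rewrite gt0_muley ?lte_fin// poweRyr ?leey// invr_neq0.
- by move: (le_trans N10 A1); rewrite leeNy_eq.
Qed.

Theorem theorem4 (R : realType) :
  exists C1 C2 : R,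
    (0 < C1 < 416 / 100)%R /\ (0 < C2 < 242 / 100)%R /\
    forall (d d' : measure_display) (Om : measurableType d)
      (E : measurableType d') (P : probability Om R)
      (n : nat) (X : 'I_n -> {RV P >-> E}) (F : n.-tuple E -> R),
    (0 < n)%N ->
    mutually_independent P X ->
    measurable_fun [set: n.-tuple E] F ->
    let Z : Om -> R := F \o rv_tuple X in
    P.-integrable [set: Om] (EFin \o Z) ->
    (forall (X' : 'I_n -> {RV P >-> E}) (Vplus : Om -> \bar R)
        (M : {RV P >-> R}),
      let Z' (i : 'I_n) : Om -> R := F \o replace_coord X X' i in
      independent_copy P (rv_tuple X) (rv_tuple X') ->
      is_cond_expectation P (rv_tuple X)
        (fun w => (\sum_(i < n) (Num.max (Z w - Z' i w) 0) ^+ 2)%R%:E) Vplus ->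
      {ae P, forall w, (0 < M w)%R} ->
      (forall i : 'I_n, {ae P, forall w, (Num.max (Z w - Z' i w) 0 <= M w)%R}) ->
      forall q : R, (2 <= q)%R ->
        'N[P]_(q%:E)[(fun w => (Z w)%:E - 'E_P[Z])^\-] <=
        ((C1 * q)%:E * maxe ('N[P]_((q / 2)%:E)[Vplus])
                            (q%:E * 'N[P]_(q%:E)[EFin \o M] ^+ 2)) `^ (2^-1)%R)
    /\
    (forall (Fdel : 'I_n -> n.-1.-tuple E -> R) (M : {RV P >-> R}),
      (forall i : 'I_n, measurable_fun [set: n.-1.-tuple E] (Fdel i)) ->
      let Zdel (i : 'I_n) : Om -> R := Fdel i \o delete_coord X i in
      let V (w : Om) : R := (\sum_(i < n) (Z w - Zdel i w) ^+ 2)%R in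
      {ae P, forall w, (0 < M w)%R} ->
      (forall i : 'I_n, {ae P, forall w, (0 <= Z w - Zdel i w <= M w)%R}) ->
      forall q : R, (2 <= q)%R ->
        'N[P]_(q%:E)[(fun w => (Z w)%:E - 'E_P[Z])^\-] <=
        ((C2 * q)%:E * maxe ('N[P]_((q / 2)%:E)[EFin \o V])
                            (q%:E * 'N[P]_(q%:E)[EFin \o M] ^+ 2)) `^ (2^-1)%R).
Proof.
exists ((53 / 26) ^+ 2)%R, ((14 / 9) ^+ 2)%R.
split; first lra.
split; first lra.
move=> d d' Om E P n X F _ indX mF Z iZ.
have q0 (q : R) : (2 <= q)%R -> (0 < q)%R by exact: lt_le_trans.
split.
- move=> X' Vplus M Z' copyX ceV M0 ZM q q2.
  apply: (scale_to_moments _ (q0 q q2) (Lnorm_ge0 _ _ _)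
    (Lnorm_gt0 (q0 q q2) M0)); first lra.
  move=> alpha al0 NV NM.
  exact: (lower_tail_incr indX mF iZ al0 q2 NM copyX ceV M0 ZM NV).
- move=> Fdel M mFdel Zdel V M0 ZM q q2.
  apply: (scale_to_moments _ (q0 q q2) (Lnorm_ge0 _ _ _)
    (Lnorm_gt0 (q0 q q2) M0)); first lra.
  move=> alpha al0 NV NM.
  exact: (lower_tail_free indX mF iZ al0 q2 NM mFdel M0 ZM NV).
Qed.
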